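(* Let $k$ be an algebraically closed field of characteristic different from $2$ and $3$, let $f\in k[x,y,z]$ be a non-singular homogeneous polynomial of degree $3$, and let $R=k[x,y,z]/(f)$ be the coordinate ring of the plane elliptic curve $Y=\mathrm{Proj}\,R$. Then the (graded) differential symmetric signature of $R$ exists and equals zero: $s_{d\sigma}(R)=0$.
   Context: $f$ non-singular means that $\mathrm{Proj}\,k[x,y,z]/(f)$ is a smooth curve. $R$ is standard graded; graded modules are finitely generated with degree-$0$ homogeneous maps. For a finitely generated graded $R$-module $M$, the graded free rank $\mathrm{frk}_R^{\mathrm{gr}}(M)$ is the maximal $n$ such that there is a homogeneous degree-$0$ split surjection $M\twoheadrightarrow F$ with $F$ a free graded $R$-module of rank $n$ (so summands $R(a)$ with any shift $a\in\mathbb Z$ are counted). $(-)^*=\mathrm{Hom}_R(-,R)$, $(-)^{**}$ is the double dual, $\Omega_{R/k}$ is the module of Kähler differentials with its natural grading, and $\mathcal C^q=\left(\mathrm{Sym}^q_R(\Omega_{R/k}^{**})\right)^{**}$ for $q\ge0$. The graded differential symmetric signature is $$s_{d\sigma}(R)=\lim_{N\to+\infty}\frac{\sum_{q=0}^N\mathrm{frk}_R^{\mathrm{gr}}\,\mathcal C^q}{\sum_{q=0}^N\mathrm{rank}_R\,\mathcal C^q},$$ provided the limit exists. *)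

(* Defs.v *)
(* The notations of multinomials clash with those
   of MathComp-Analysis, so that [mpoly] is imported without its notations. *)
From HB Require Import structures.
From mathcomp Require Import all_boot all_order all_algebra.
From mathcomp Require Import perm generic_quotient ring_quotient.
From mathcomp Require Import boolp classical_sets functions cardinality.
From mathcomp Require Import reals topology normedtype.
From mathcomp Require Import -(notations) mpoly.

Set Implicit Arguments.
Unset Strict Implicit.
Unset Printing Implicit Defensive.

Import Order.TTheory GRing.Theory Num.Theory.
Import numFieldNormedType.Exports.
Local Open Scope classical_set_scope.
Local Open Scope ring_scope.
Local Open Scope quotient_scope.

Section Span.
Variables (A : comPzRingType) (V : lmodType A).

Definition add_span (S : set V) : set V :=
  smallest [set W : set V | W 0 /\ forall u v, W u -> W v -> W (u - v)] S.

Definition submod_span (S : set V) : set V :=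
  smallest [set W : set V |
    W 0 /\ forall (a : A) u v, W u -> W v -> W (a *: u + v)] S.

Definition submod_pred (S : set V) : {pred V} := fun v => `[< submod_span S v >].

Lemma submod_pred_closed (S : set V) : submod_closed (submod_pred S).
Proof.
split; first by apply/asboolP => W [[]].
move=> a u v /asboolP uS /asboolP vS; apply/asboolP => W WS.
by case: (WS) => -[_ Wl] _; apply: Wl; [exact: uS | exact: vS].
Qed.

HB.instance Definition _ S :=
  GRing.isSubmodClosed.Build A V (submod_pred S) (submod_pred_closed S).

End Span.

Section QuotientModule.
Variables (A : comPzRingType) (V : lmodType A) (S : set V).

Definition quot_mod := Quotient.quot (submod_pred S).
HB.instance Definition _ := GRing.Zmodule.on quot_mod.

Definition quot_scale (a : A) (x : quot_mod) : quot_mod :=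
  \pi_(Quotient.quot (submod_pred S)) (a *: repr x).

Lemma quot_scale_pi (a : A) (v : V) :
  quot_scale a (\pi_(Quotient.quot (submod_pred S)) v)
    = \pi_(Quotient.quot (submod_pred S)) (a *: v).
Proof.
apply/eqP; rewrite -Quotient.idealrBE -scalerBr rpredZ //.
by rewrite Quotient.idealrBE reprK.
Qed.

Lemma quot_scaleA a b x : quot_scale a (quot_scale b x) = quot_scale (a * b) x.
Proof. by rewrite [quot_scale b x]/quot_scale quot_scale_pi scalerA. Qed.

Lemma quot_scale1 : left_id 1 quot_scale.
Proof. by move=> x; rewrite /quot_scale scale1r reprK. Qed.

Lemma quot_scaleDr : right_distributive quot_scale +%R.
Proof.
move=> a x y; rewrite -[x in LHS]reprK -[y in LHS]reprK.
by rewrite -[_ + _]raddfD quot_scale_pi scalerDr raddfD.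
Qed.

Lemma quot_scaleDl x : {morph quot_scale^~ x : a b / a + b}.
Proof. by move=> a b; rewrite /quot_scale scalerDl raddfD. Qed.

HB.instance Definition _ := GRing.Zmodule_isLmodule.Build A quot_mod
  quot_scaleA quot_scale1 quot_scaleDr quot_scaleDl.

End QuotientModule.

Section FreeModule.
Variables (A : comPzRingType) (X : eqType).

Definition finsupp_pred : {pred X -> A^o} :=
  fun c => `[< finite_set [set x | c x != 0] >].

Lemma finsupp_pred_closed : submod_closed finsupp_pred.
Proof.
split=> [|a c d /asboolP fc /asboolP fd]; apply/asboolP.
  by apply: (sub_finite_set _ (@finite_set0 X)) => x /=; rewrite eqxx.
apply: (@sub_finite_set _ _ ([set x | c x != 0] `|` [set x | d x != 0])).
  move=> x /= nz; apply: contrapT => /not_orP[/negP/negPn/eqP c0].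
  move=> /negP/negPn/eqP d0; case/eqP: nz.
  by rewrite -[LHS]/(a *: c x + d x) c0 d0 scaler0 addr0.
by rewrite finite_setU.
Qed.

HB.instance Definition _ :=
  GRing.isSubmodClosed.Build A (X -> A^o) finsupp_pred finsupp_pred_closed.

Record free_mod := FreeMod
  { free_coef :> X -> A^o; free_coef_finsupp : free_coef \in finsupp_pred }.

HB.instance Definition _ := [isSub for free_coef].
HB.instance Definition _ := [Choice of free_mod by <:].
HB.instance Definition _ := [SubChoice_isSubLmodule of free_mod by <:].

Lemma free_gen_finsupp (x : X) :
  (fun y => (y == x)%:R : A^o) \in finsupp_pred.
Proof.
apply/asboolP; apply: (sub_finite_set _ (finite_set1 x)) => y /=.
by case: (y =P x) => // _; rewrite eqxx.
Qed.

Definition free_gen (x : X) : free_mod := FreeMod (free_gen_finsupp x).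

End FreeModule.

Arguments free_gen A {X} x.

Section Dual.
Variables (A : comPzRingType) (M : lmodType A).

Definition linear_pred : {pred M -> A^o} := fun g => `[< linear g >].

Lemma linear_pred_closed : submod_closed linear_pred.
Proof.
split=> [|a g h /asboolP lg /asboolP lh]; apply/asboolP => b u v.
  by rewrite /= scaler0 addr0.
rewrite !fctE lg lh !scalerDr !scalerA (mulrC a b).
by rewrite addrACA.
Qed.

HB.instance Definition _ :=
  GRing.isSubmodClosed.Build A (M -> A^o) linear_pred linear_pred_closed.

Record dual := Dual { dual_fun :> M -> A^o; dual_lin : dual_fun \in linear_pred }.

HB.instance Definition _ := [isSub for dual_fun].
HB.instance Definition _ := [Choice of dual by <:].
HB.instance Definition _ := [SubChoice_isSubLmodule of dual by <:].

End Dual.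

(* Graded modules over a graded ring [A] with homogeneous components [gA i]:
   [gdeg i] is the set of homogeneous elements of degree [i] (including 0).  The
   axioms of a grading are not part of the record: every instance below is an
   explicit construction. *)
Record gmod (A : comPzRingType) := GMod
  { gcar :> lmodType A; gdeg : int -> set gcar }.

Section Graded.
Variables (A : comPzRingType) (gA : int -> set A).

Definition gdual (M : gmod A) : gmod A :=
  @GMod A (dual M) (fun i => [set phi : dual M |
    forall (j : int) (m : M), gdeg j m -> gA (i + j) (phi m)]).

Definition gbidual (M : gmod A) : gmod A := gdual (gdual M).

(* Module with generators [X] and relations [S], the generators [x] with
   [hX i x] being given degree [i]. *)
Definition presented (X : eqType) (hX : int -> set X)
    (S : set (free_mod A X)) : gmod A :=
  @GMod A (quot_mod S) (fun i => add_span [set w : quot_mod S |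
    exists (j l : int) (a : A) (x : X),
      [/\ i = j + l, gA j a, hX l x &
          w = a *: (\pi_(Quotient.quot (submod_pred S)) (free_gen A x) : quot_mod S)]]).

(* Kaehler differentials of [A] over [k], where [iota : k -> A] is the structure
   map; the generator [b] stands for [d b]. *)
Definition kahler (k : Type) (iota : k -> A) : gmod A :=
  let d := @free_gen A A in
  presented gA
    [set w | [\/ exists a b : A, w = d (a + b) - d a - d b,
                 exists a b : A, w = d (a * b) - a *: d b - b *: d a |
                 exists c : k, w = d (iota c)]].

Definition upd (M : lmodType A) (q : nat) (t : {ffun 'I_q -> M}) (i : 'I_q)
  (u : M) : {ffun 'I_q -> M} := [ffun j => if j == i then u else t j].

(* The generator [t] stands for the product of the [t i]; it is homogeneous when
   all [t i] are. *)
Definition gsym (q : nat) (M : gmod A) : gmod A :=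
  let e := @free_gen A {ffun 'I_q -> M} in
  presented
    (fun l => [set t : {ffun 'I_q -> M} | exists dt : 'I_q -> int,
       l = \sum_(i < q) dt i /\ forall i, gdeg (dt i) (t i)])
    [set w | (exists (t : {ffun 'I_q -> M}) (i : 'I_q) (a : A) (u v : M),
                w = e (upd t i (a *: u + v))
                    - (a *: e (upd t i u) + e (upd t i v))) \/
             (exists (t : {ffun 'I_q -> M}) (s : {perm 'I_q}),
                w = e [ffun i => t (s i)] - e t)].

(* The graded free module [A(a_1) + ... + A(a_n)], with [A(a)_j = A_(a + j)]. *)
Definition gfree (n : nat) (a : 'I_n -> int) : gmod A :=
  @GMod A 'rV[A]_n (fun j => [set v : 'rV[A]_n |
    forall i, gA (a i + j) (v ord0 i)]).

Definition homog0 (M N : gmod A) (phi : M -> N) : Prop :=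
  forall (j : int) (m : M), gdeg j m -> gdeg j (phi m).

Definition splits_free (M : gmod A) (n : nat) : Prop :=
  exists (a : 'I_n -> int) (phi : {linear M -> gfree a})
         (sec : {linear gfree a -> M}),
    [/\ homog0 phi, homog0 sec & cancel sec phi].

Definition is_maximum (P : set nat) (n : nat) : Prop :=
  P n /\ forall m, P m -> (m <= n)%N.

Definition is_frk (M : gmod A) (n : nat) : Prop :=
  is_maximum (splits_free M) n.

(* Maximal number of linearly independent elements: for [A] a domain this is the
   dimension of [M] tensored with the fraction field of [A]. *)
Definition is_rank (M : gmod A) (n : nat) : Prop :=
  is_maximum [set r | exists v : 'I_r -> M, forall c : 'I_r -> A,
    \sum_(i < r) c i *: v i = 0 -> forall i, c i = 0] n.

End Graded.

Section CoordinateRing.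
Variables (k : fieldType) (f : mpoly 3 k).

Definition ideal_pred : {pred mpoly 3 k} :=
  fun p => `[< exists q, p = q * f >].

Lemma ideal_pred_closed : zmod_closed ideal_pred.
Proof.
split=> [|p q /asboolP[a ->] /asboolP[b ->]]; apply/asboolP.
  by exists 0; rewrite mul0r.
by exists (a - b); rewrite mulrBl.
Qed.

HB.instance Definition _ :=
  GRing.isZmodClosed.Build (mpoly 3 k) ideal_pred ideal_pred_closed.

Lemma ideal_predM p q : q \in ideal_pred -> p * q \in ideal_pred.
Proof. by case/asboolP=> a ->; apply/asboolP; exists (p * a); rewrite mulrA. Qed.

Definition coord_ring := Quotient.quot ideal_pred.
HB.instance Definition _ := GRing.Zmodule.on coord_ring.

Definition to_coord (p : mpoly 3 k) : coord_ring := \pi_(Quotient.quot ideal_pred) p.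

Definition coord_mul (x y : coord_ring) : coord_ring :=
  to_coord (repr x * repr y).

Lemma coord_mul_pi p q : coord_mul (to_coord p) (to_coord q) = to_coord (p * q).
Proof.
have modE r : repr (to_coord r) - r \in ideal_pred.
  by rewrite Quotient.idealrBE reprK.
apply/eqP; rewrite -Quotient.idealrBE.
set p' := repr _; set q' := repr _.
have -> : p' * q' - p * q = p' * (q' - q) + q * (p' - p).
  by rewrite !mulrBr (mulrC q p') (mulrC q p) addrA subrK.
by rewrite rpredD // ideal_predM // modE.
Qed.

Lemma to_coord_repr (x : coord_ring) : to_coord (repr x) = x.
Proof. exact: reprK. Qed.

Lemma to_coordD : {morph to_coord : p q / p + q}.
Proof. exact: raddfD. Qed.

Lemma coord_mulA : associative coord_mul.
Proof.
move=> x y z; rewrite -(to_coord_repr x) -(to_coord_repr y) -(to_coord_repr z).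
by rewrite !coord_mul_pi mulrA.
Qed.

Lemma coord_mulC : commutative coord_mul.
Proof. by move=> x y; rewrite /coord_mul mulrC. Qed.

Lemma coord_mul1 : left_id (to_coord 1) coord_mul.
Proof. by move=> x; rewrite -(to_coord_repr x) coord_mul_pi mul1r. Qed.

Lemma coord_mulDl : left_distributive coord_mul +%R.
Proof.
move=> x y z; rewrite -(to_coord_repr x) -(to_coord_repr y) -(to_coord_repr z).
by rewrite -to_coordD !coord_mul_pi mulrDl to_coordD.
Qed.

HB.instance Definition _ := GRing.Zmodule_isComPzRing.Build coord_ring
  coord_mulA coord_mulC coord_mul1 coord_mulDl.

(* [mdeg] is the total degree of monomials: the standard grading. *)
Definition coord_deg (i : int) : set coord_ring :=
  if i is Posz n then to_coord @` [set p | p \is ishomog1 n mdeg] else [set 0].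

(* Smoothness of [Proj k[x,y,z]/(f)], which is covered by the affine curves obtained by setting one of
   the variables to 1; each of them is smooth by the Jacobian criterion at its
   closed points ([k] is meant to be algebraically closed). *)
Definition nonsingular : Prop :=
  forall (i : 'I_3) (v : 'I_3 -> k), v i = 1 -> meval v f = 0 ->
    exists2 j : 'I_3, j != i & meval v (mderiv j f) != 0.

Definition coord_kahler : gmod coord_ring :=
  kahler coord_deg (fun c : k => to_coord (mpolyC 3 c)).

Definition calC (q : nat) : gmod coord_ring :=
  gbidual coord_deg (gsym coord_deg q (gbidual coord_deg coord_kahler)).

(* The graded differential symmetric signature exists and equals [s]. *)
Definition is_diff_signature (K : realType) (s : K) : Prop :=
  exists frk rk : nat -> nat,
    [/\ forall q, is_frk coord_deg (calC q) (frk q),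
        forall q, is_rank (calC q) (rk q) &
        ((\sum_(0 <= q < N.+1) frk q)%:R / (\sum_(0 <= q < N.+1) rk q)%:R : K)
          @[N --> \oo] --> s].

End CoordinateRing.

(* Main.v *)
(** Put Omega = Omega_{R/k}^{**}, and let E be the rank two bundle it defines on the curve.
    The Euler derivation maps E onto O, and its kernel is generated by the invariant
    differential [w]; hence E is an extension of O by O.  Take a point P off the curve and
    two lines u, v through P.  They form a regular sequence in R, and the class of the
    extension is the Cech class g / (u v), where g is the polar conic of P.  It does not
    vanish because g is not in (u, v) R when the characteristic is not 3.

    A free summand of C^q is a pair (s, phi) with phi s = 1.  By comparing degrees along the
    filtration of Sym^q E by powers of [w] one sees that it is generated in degree 0 and
    that the coefficient of s in Sym^q (E / O w) = O is a constant.  If that constant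
    vanishes, then s = w t, and e |-> phi (e t) would split the extension.  Two summands can
    be combined so as to kill the constant, so the free rank of C^q is at most 1, in every
    characteristic, whereas its rank is q + 1. *)
Require Import Defs.
From HB Require Import structures.
From mathcomp Require Import all_boot all_order all_algebra.
From mathcomp Require Import perm generic_quotient ring_quotient.
From mathcomp Require Import boolp classical_sets cardinality.
From mathcomp Require Import reals topology normedtype sequences.
From mathcomp Require Import -(notations) mpoly.
From mathcomp Require Import ring zify.

Set Implicit Arguments.
Unset Strict Implicit.
Unset Printing Implicit Defensive.

Import Order.TTheory GRing.Theory Num.Theory.
Import numFieldNormedType.Exports.
Local Open Scope classical_set_scope.
Local Open Scope ring_scope.
Local Open Scope quotient_scope.

(** No sheaf is formed. Localising at [u] is replaced by multiplying by a power of [u] and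
    cancelling it, and gluing by a divisibility: since [u], [v] form a regular sequence, an equation
    [v ^ n a = u ^ m b] makes [u ^ m] divide [a]. Double duals are handled through pairings: an
    element of C^q is known by its values on the functionals [theta], a functional on C^q by its
    values on the monomials [smono], and up to the factor [u ^ q] these two lists determine the
    pairing. The position of P off the curve serves three ends: it makes [u], [v] a regular sequence
    on R; it makes [f] monic, up to a unit, in a chart variable pointing towards P, so that
    elimination applies; and by Euler's formula the polar conic takes at P the value [3 f(P)], which
    keeps it out of the ideal of [u] and [v]. Smoothness yields the invariant differential: powers
    of [u] and of [v] lie in the Jacobian ideal, which allows the cross product of a derivation with
    the position vector to be divided by the gradient of [f]. *)

Local Notation mX i := (mpolyX _ (mnm1 i)).

(** * Modules given by generators and relations *)

Section FreeLift.
Variables (A : comPzRingType) (X : eqType) (V : lmodType A) (h : X -> V).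

Lemma free_support (w : free_mod A X) :
  exists s : seq X, uniq s /\ forall x, w x != 0 -> x \in s.
Proof.
have /asboolP/finite_seqP[s sE] := free_coef_finsupp w.
exists (undup s); split=> [|x wx]; first exact: undup_uniq.
have : [set x | w x != 0] x by [].
by rewrite sE mem_undup.
Qed.

(** The list is an arbitrary choice; [free_liftE] makes the value independent of it, so that
    linearity can be checked on a list common to two elements. *)
Definition free_lift (w : free_mod A X) : V :=
  \sum_(x <- projT1 (cid (free_support w))) w x *: h x.

Lemma free_liftE (w : free_mod A X) (s : seq X) :
  uniq s -> (forall x, w x != 0 -> x \in s) ->
  free_lift w = \sum_(x <- s) w x *: h x.
Proof.
rewrite /free_lift; case: cid => s' /= [us' ws'] us ws.
have restr t : \sum_(x <- t) w x *: h x = \sum_(x <- t | w x != 0) w x *: h x.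
  rewrite [LHS](bigID (fun x => w x != 0)) /= [X in _ + X]big1 ?addr0 //.
  by move=> x /negPn/eqP->; rewrite scale0r.
rewrite (restr s) (restr s') -big_filter -[RHS]big_filter.
apply: perm_big; apply: uniq_perm; rewrite ?filter_uniq // => x.
rewrite !mem_filter; have [//|wx /=] := boolP (w x == 0).
by rewrite ws' // ws.
Qed.

Lemma free_lift_linear : linear free_lift.
Proof.
move=> a w1 w2.
have [s1 [us1 ws1]] := free_support w1.
have [s2 [us2 ws2]] := free_support w2.
set s := undup (s1 ++ s2).
have us : uniq s by exact: undup_uniq.
have s1P x : w1 x != 0 -> x \in s by rewrite mem_undup mem_cat => /ws1->.
have s2P x : w2 x != 0 -> x \in s.
  by rewrite mem_undup mem_cat => /ws2->; rewrite orbT.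
rewrite (free_liftE us s1P) (free_liftE us s2P) (@free_liftE _ s us).
  rewrite scaler_sumr -big_split /=; apply: eq_bigr => x _.
  by rewrite scalerA -scalerDl.
move=> x; have [w1x|/s1P //] := eqVneq (w1 x) 0.
have [w2x|/s2P //] := eqVneq (w2 x) 0.
have -> : (a *: w1 + w2) x = a *: w1 x + w2 x by [].
by rewrite w1x w2x scaler0 addr0 eqxx.
Qed.
HB.instance Definition _ :=
  GRing.isLinear.Build A (free_mod A X) V _ free_lift free_lift_linear.

Lemma free_lift_gen x : free_lift (free_gen A x) = h x.
Proof.
rewrite (@free_liftE _ [:: x]) //= ?big_seq1 ?eqxx ?scale1r //.
by move=> y; rewrite inE; case: (y == x); rewrite ?eqxx.
Qed.

End FreeLift.

Lemma free_coef_sum (A : comPzRingType) (X : eqType) (s : seq X)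
    (F : X -> free_mod A X) (y : X) :
  (\sum_(x <- s) F x) y = \sum_(x <- s) F x y.
Proof.
elim: s => [|x s IHs]; first by rewrite !big_nil.
by rewrite !big_cons -IHs.
Qed.

Lemma free_mod_span (A : comPzRingType) (X : eqType) (w : free_mod A X) :
  w = free_lift (@free_gen A X) w.
Proof.
have [s [us ws]] := free_support w.
rewrite (free_liftE _ us ws); apply/val_inj/funext => y /=.
rewrite free_coef_sum.
have [ys|yNs] := boolP (y \in s).
  rewrite (bigD1_seq y) //= big1 ?addr0; last first.
    move=> x /negPf xy; rewrite -[LHS]/(w x * (y == x)%:R).
    by rewrite eq_sym xy mulr0.
  by rewrite -[RHS]/(w y * (y == y)%:R) eqxx mulr1.
have /eqP -> : w y == 0 by apply/negPn; apply: contra yNs => /ws.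
rewrite big_seq big1 // => x xs; rewrite -[LHS]/(w x * (y == x)%:R).
by case: eqP => [yx|]; rewrite ?mulr0 //; move: yNs; rewrite yx xs.
Qed.

Lemma free_mod_ext (A : comPzRingType) (X : eqType) (V : lmodType A)
    (phi psi : {linear free_mod A X -> V}) :
  (forall x, phi (free_gen A x) = psi (free_gen A x)) -> phi =1 psi.
Proof.
move=> eq_gen w; rewrite (free_mod_span w).
have [s [us ws]] := free_support w; rewrite (free_liftE _ us ws) !linear_sum.
by apply: eq_bigr => x _; rewrite !linearZ /= eq_gen.
Qed.

Section QuotLift.
Variables (A : comPzRingType) (X : eqType) (S : set (free_mod A X)).

Definition quot_gen (x : X) : quot_mod S :=
  \pi_(Quotient.quot (submod_pred S)) (free_gen A x).

Definition quot_pi (w : free_mod A X) : quot_mod S :=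
  \pi_(Quotient.quot (submod_pred S)) w.

Lemma quot_pi_linear : linear quot_pi.
Proof.
move=> a u v; have uE := quot_scale_pi S a u.
by rewrite /quot_pi raddfD /= -uE.
Qed.
HB.instance Definition _ :=
  GRing.isLinear.Build A (free_mod A X) (quot_mod S) _ quot_pi quot_pi_linear.

Lemma quot_pi_repr (x : quot_mod S) : exists w, x = quot_pi w.
Proof. by exists (repr x); rewrite /quot_pi reprK. Qed.

Lemma quot_pi_rel w : S w -> quot_pi w = 0.
Proof.
move=> Sw; apply/eqP.
rewrite -(raddf0 (\pi_(Quotient.quot (submod_pred S)))) /= -Quotient.idealrBE.
by rewrite subr0; apply/asboolP => W [_]; apply.
Qed.

Lemma quot_mod_ext (V : lmodType A) (phi psi : {linear quot_mod S -> V}) :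
  (forall x, phi (quot_gen x) = psi (quot_gen x)) -> phi =1 psi.
Proof.
move=> eq_gen q; have [w ->] := quot_pi_repr q.
exact: (free_mod_ext (phi := phi \o quot_pi) (psi := psi \o quot_pi)).
Qed.

(** The kernel of [free_lift h] is a submodule, so it contains the span of [S], and evaluating on a
    chosen representative is well defined. *)
Lemma quot_mod_lift (V : lmodType A) (h : X -> V) :
  (forall w, S w -> free_lift h w = 0) ->
  exists phi : {linear quot_mod S -> V}, forall x, phi (quot_gen x) = h x.
Proof.
move=> hS.
have hS' w : submod_span S w -> free_lift h w = 0.
  move=> /(_ [set w | free_lift h w = 0]); apply; split=> [|w' /hS //].
  split=> [|a u v /= u0 v0]; first exact: linear0.
  by rewrite linearP /= u0 v0 scaler0 addr0.
have lift_pi w : free_lift h (repr (quot_pi w)) = free_lift h w.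
  apply/eqP; rewrite -subr_eq0 -linearB /=; apply/eqP/hS'/asboolP.
  have := Quotient.idealrBE (submod_pred S) (repr (quot_pi w)) w.
  by rewrite /quot_pi reprK eqxx.
have lin : linear (fun q : quot_mod S => free_lift h (repr q)).
  move=> a p q; have [u ->] := quot_pi_repr p; have [v ->] := quot_pi_repr q.
  have -> : a *: quot_pi u + quot_pi v = quot_pi (a *: u + v) by rewrite linearP.
  by rewrite !lift_pi linearP.
pose phi : {linear quot_mod S -> V} :=
  HB.pack (fun q : quot_mod S => free_lift h (repr q))
    (GRing.isLinear.Build A (quot_mod S) V _ _ lin).
by exists phi => x; rewrite /phi /= lift_pi free_lift_gen.
Qed.

End QuotLift.

(** * Symmetric powers and double duals *)

Section Multilinear.
Variables (A : comPzRingType) (M V : lmodType A) (q : nat).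
Implicit Type G : {ffun 'I_q -> M} -> V.

Definition multilin G := forall t i (a : A) u v,
  G (upd t i (a *: u + v)) = a *: G (upd t i u) + G (upd t i v).

Definition symfun G := forall (t : {ffun 'I_q -> M}) (s : {perm 'I_q}),
  G [ffun i => t (s i)] = G t.

End Multilinear.

Lemma upd_same (A : comPzRingType) (M : lmodType A) q (t : {ffun 'I_q -> M}) i :
  upd t i (t i) = t.
Proof. by apply/ffunP => j; rewrite !ffunE; case: eqP => [->|]. Qed.

Section SymPower.
Variables (A : comPzRingType) (gA : int -> set A) (M : gmod A) (q : nat).

Definition sgen (t : {ffun 'I_q -> M}) : gsym gA q M := quot_gen _ t.

Lemma sgen_lift (V : lmodType A) (G : {ffun 'I_q -> M} -> V) :
  multilin G -> symfun G ->
  exists phi : {linear gsym gA q M -> V}, forall t, phi (sgen t) = G t.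
Proof.
move=> mG sG; apply: quot_mod_lift => w [[t [i [a [u [v ->]]]]]|[t [s ->]]].
  by rewrite linearB linearD linearZ /= !free_lift_gen mG subrr.
by rewrite linearB /= !free_lift_gen sG subrr.
Qed.

Lemma sgen_multilin (V : lmodType A) (phi : {linear gsym gA q M -> V}) :
  multilin (phi \o sgen).
Proof.
move=> t i a u v /=; rewrite -linearP; congr (phi _).
apply/eqP; rewrite -subr_eq0; apply/eqP.
rewrite /sgen -[_ - _]/(quot_pi _ _ - (a *: quot_pi _ _ + quot_pi _ _)).
rewrite -linearP -linearB; apply: quot_pi_rel.
by left; exists t, i, a, u, v.
Qed.

Lemma sgen_sym (V : lmodType A) (phi : {linear gsym gA q M -> V}) :
  symfun (phi \o sgen).
Proof.
move=> t s /=; congr (phi _); apply/eqP; rewrite -subr_eq0; apply/eqP.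
rewrite /sgen -[_ - _]/(quot_pi _ _ - quot_pi _ _) -linearB.
apply: quot_pi_rel.
by right; exists t, s.
Qed.

Lemma sgen_ext (V : lmodType A) (phi psi : {linear gsym gA q M -> V}) :
  (forall t, phi (sgen t) = psi (sgen t)) -> phi =1 psi.
Proof. exact: quot_mod_ext. Qed.

End SymPower.

Section MixedExpansion.
Variables (A : comNzRingType) (M V : lmodType A) (m : nat).
Variable G : {ffun 'I_m -> M} -> V.
Hypotheses (mG : multilin G) (sG : symfun G).

Definition mono (x y : M) (i : nat) : {ffun 'I_m -> M} :=
  [ffun j : 'I_m => if (j < i)%N then x else y].

(** Slots are expanded one at a time. Symmetry moves every [x] chosen so far to the front, so a term
    depends only on the number [i] of its factors [x], and the coefficients collect as those of a
    product of linear polynomials. *)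
Lemma multilin_expand (a b : 'I_m -> A) (x y : M) :
  G [ffun j => a j *: x + b j *: y] =
  \sum_(i < m.+1) (\prod_j ((b j)%:P + (a j)%:P * 'X))`_i *: G (mono x y i).
Proof.
pose t := [ffun j => a j *: x + b j *: y].
pose w i k : {ffun 'I_m -> M} :=
  [ffun j : 'I_m => if (j < i)%N then x else if (j < k)%N then y else t j].
pose P k : {poly A} := \prod_(j < m | (j < k)%N) ((b j)%:P + (a j)%:P * 'X).
have Pprod : \prod_j ((b j)%:P + (a j)%:P * 'X) = P m.
  by apply: eq_bigl => j; rewrite ltn_ord.
suff expand k : (k <= m)%N -> (size (P k) <= k.+1)%N /\
    G t = \sum_(i < k.+1) (P k)`_i *: G (w i k).
  have [//|_ ->] := expand m; rewrite Pprod; apply: eq_bigr => i _; congr (_ *: G _).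
  by apply/ffunP => j; rewrite !ffunE ltn_ord.
elim: k => [|k IHk] km.
  rewrite /P big_pred0 // size_poly1; split=> //.
  rewrite big_ord1 coef1 eqxx scale1r; congr G.
  by apply/ffunP => j; rewrite !ffunE.
pose ko := Ordinal km.
have PS : P k.+1 = (b ko)%:P * P k + (a ko)%:P * (P k * 'X).
  rewrite /P (bigD1 ko) ?ltnSn //= mulrDl; congr (_ + _).
    congr (_ * _); apply: eq_bigl => j.
    by rewrite ltnS [RHS]ltn_neqAle -val_eqE andbC.
  rewrite -mulrA (mulrC 'X); congr (_ * (_ * _)); apply: eq_bigl => j.
  by rewrite ltnS [RHS]ltn_neqAle -val_eqE andbC.
have step i : (i <= k)%N ->
    G (w i k) = a ko *: G (w i.+1 k.+1) + b ko *: G (w i k.+1).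
  move=> ik.
  have wt : w i k = upd (w i k) ko (a ko *: x + b ko *: y).
    rewrite -[LHS](upd_same _ ko); congr upd; rewrite !ffunE /=.
    by rewrite (ltnNge k i) ik ltnn.
  have wy : upd (w i k) ko y = w i k.+1.
    apply/ffunP => j; rewrite !ffunE -val_eqE /= ltnS.
    by case: (ltngtP j k) => // ->; rewrite (ltnNge k) ik.
  (* The new [x] in slot [k] is moved to slot [i], next to the earlier ones. *)
  have wx : G (upd (w i k) ko x) = G (w i.+1 k.+1).
    have im : (i < m)%N by exact: (leq_ltn_trans ik).
    rewrite -[RHS](sG _ (tperm (Ordinal im) ko)); congr G.
    apply/ffunP => j; rewrite !ffunE; case: tpermP => [->|->|].
    - rewrite -!val_eqE /= !ltnS leqnn ltnn eq_sym.
      by case: ltngtP ik.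
    - by rewrite /= ltnS leqnn eqxx.
    - move=> /eqP/negPf; rewrite -val_eqE /= => ji /eqP/negPf.
      by rewrite -!val_eqE /= => jk; rewrite !ltnS !(leq_eqVlt j) /= ji jk.
  have e0 : G (upd (w i k) ko 0) = 0.
    have := mG (w i k) ko (-1) 0 0; rewrite scaler0 addr0 scaleN1r => ->.
    by rewrite addNr.
  rewrite wt mG wx; congr (_ + _); rewrite -wy -[b ko *: y]addr0 mG.
  by rewrite e0 addr0.
have [szP ->] := IHk (ltnW km); split.
  rewrite PS !mul_polyC (leq_trans (size_polyD _ _)) // geq_max.
  apply/andP; split; apply: leq_trans (size_scale_leq _ _) _; first exact: leqW.
  by rewrite (leq_trans (size_polyMleq _ _)) // size_polyX addn2.
rewrite PS; under [RHS]eq_bigr do rewrite coefD !coefCM coefMX scalerDl.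
rewrite big_split /= [X in _ = X + _]big_ord_recr /= (nth_default 0 szP).
rewrite mulr0 scale0r addr0 [X in _ = _ + X]big_ord_recl /= mulr0 scale0r add0r.
rewrite -big_split /=; apply: eq_bigr => i _.
rewrite step -1?ltnS // scalerDr !scalerA addrC.
by rewrite (mulrC _ (b ko)) (mulrC _ (a ko)).
Qed.

End MixedExpansion.

Lemma prod_if_lt (R : comPzSemiRingType) m l (x y : R) : (l <= m)%N ->
  \prod_(j < m) (if (j < l)%N then x else y) = x ^+ l * y ^+ (m - l).
Proof.
move=> /subnKC; move: (m - l)%N => k <-; rewrite big_split_ord /=; congr (_ * _).
  by under eq_bigr do rewrite ltn_ord; rewrite prodr_const card_ord.
under eq_bigr do rewrite ltnNge leq_addr /=.
by rewrite prodr_const card_ord.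
Qed.

(** * Duals and evaluation into the double dual *)

Section DualTheory.
Variables (A : comPzRingType) (M : lmodType A).

Lemma dual_linear (g : dual M) : linear g.
Proof. exact/asboolP/(dual_lin g). Qed.
HB.instance Definition _ (g : dual M) :=
  GRing.isLinear.Build A M A^o _ (dual_fun g) (dual_linear g).

Lemma dual_ext (g h : dual M) : g =1 h -> g = h.
Proof. by move=> gh; apply/val_inj/funext. Qed.

Lemma linear_dual (phi : {linear M -> A^o}) : exists g : dual M, g =1 phi.
Proof.
have lphi : (phi : M -> A^o) \in @linear_pred A M.
  by apply/asboolP => a u v; rewrite linearP.
by exists (Dual lphi).
Qed.

End DualTheory.

Section Evaluation.
Variables (A : comPzRingType) (M : lmodType A).

Definition eval_fun (m : M) (g : dual M) : A^o := g m.

Lemma eval_fun_linear m : linear (eval_fun m).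
Proof. by []. Qed.
HB.instance Definition _ m :=
  GRing.isLinear.Build A (dual M) A^o _ (eval_fun m) (eval_fun_linear m).

Definition eval (m : M) : dual (dual M) :=
  Dual (introT (asboolP _) (eval_fun_linear m)
        : eval_fun m \in @linear_pred A (dual M)).

Lemma eval_linear : linear eval.
Proof. by move=> a m n; apply: dual_ext => g; exact: linearP. Qed.
HB.instance Definition _ :=
  GRing.isLinear.Build A M (dual (dual M)) _ eval eval_linear.

End Evaluation.

Section DualOperations.
Variables (A : comPzRingType) (M : lmodType A).

Lemma dualZE a (g : dual M) m : (a *: g) m = a * g m. Proof. by []. Qed.
Lemma dualDE (g h : dual M) m : (g + h) m = g m + h m. Proof. by []. Qed.
Lemma dual_appZ (g : dual M) a m : g (a *: m) = a * g m.
Proof. exact: linearZ. Qed.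
Lemma dual_sumE n (g : 'I_n -> dual M) m :
  (\sum_(i < n) g i) m = \sum_(i < n) g i m.
Proof.
elim: n g => [|n IHn] g; first by rewrite !big_ord0.
by rewrite !big_ord_recl dualDE IHn.
Qed.

End DualOperations.

Lemma multilin_scale (A : comPzRingType) (M V : lmodType A) q
    (G : {ffun 'I_q -> M} -> V) (a : A) (t : {ffun 'I_q -> M}) :
  multilin G -> G [ffun j => a *: t j] = a ^+ q *: G t.
Proof.
move=> mG.
pose w k : {ffun 'I_q -> M} := [ffun j : 'I_q => if (j < k)%N then a *: t j else t j].
suff scale k : (k <= q)%N -> G (w k) = a ^+ k *: G t.
  by rewrite -scale //; congr G; apply/ffunP => j; rewrite !ffunE ltn_ord.
elim: k => [_|k IHk kq].
  by rewrite scale1r; congr G; apply/ffunP => j; rewrite !ffunE.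
pose ko := Ordinal kq.
have wS : w k.+1 = upd (w k) ko (a *: t ko + 0).
  apply/ffunP => j; rewrite !ffunE addr0 -val_eqE /= ltnS leq_eqVlt.
  by case: eqP => [jk|] //=; congr (_ *: t _); apply/val_inj.
have w0 : G (upd (w k) ko 0) = 0.
  have := mG (w k) ko (-1) 0 0; rewrite scaler0 addr0 scaleN1r => ->.
  by rewrite addNr.
have wE : w k = upd (w k) ko (t ko).
  by rewrite -[LHS](upd_same _ ko); congr upd; rewrite !ffunE ltnn.
by rewrite wS mG w0 addr0 -wE IHk ?(ltnW kq) // scalerA exprS.
Qed.

(** * Monomial bases of symmetric powers on a chart *)

Section Chart.
Variables (A : comNzRingType) (gA : int -> set A) (E : gmod A).
Variables (eu h : {linear E -> A^o}) (d w : E) (u : A).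
(* On the open set [u <> 0] the fractions [d / u], [w / u] are the basis of [E] dual to
   [eu], [h]. *)
Hypothesis chartE : forall e, u *: e = eu e *: d + h e *: w.
Hypotheses (eu_d : eu d = u) (eu_w : eu w = 0) (h_d : h d = 0) (h_w : h w = u).

Section Degree.
Variable q : nat.
Local Notation N := (gsym gA q E).

Lemma chart_form (V : lmodType A) (G : {ffun 'I_q -> E} -> V) t :
  multilin G -> symfun G ->
  u ^+ q *: G t =
  \sum_(i < q.+1) (\prod_j ((h (t j))%:P + (eu (t j))%:P * 'X))`_i *: G (mono q d w i).
Proof.
move=> mG sG; rewrite -multilin_scale // -multilin_expand //; congr G.
by apply/ffunP => j; rewrite !ffunE chartE.
Qed.

(* As coefficients of a product these functionals are the divided monomials in [h] and
   [eu]: no factorial is inverted, so the characteristic plays no role. *)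
Definition ftheta (t : {ffun 'I_q -> E}) (i : nat) : A^o :=
  (\prod_j ((h (t j))%:P + (eu (t j))%:P * 'X))`_i.

Lemma ftheta_multilin i : multilin (ftheta ^~ i).
Proof.
move=> t j a x y; rewrite /ftheta !(bigD1 j (P := xpredT)) //=.
have same z : \prod_(l | l != j)
   ((h (upd t j z l))%:P + (eu (upd t j z l))%:P * 'X) =
   \prod_(l | l != j) ((h (t l))%:P + (eu (t l))%:P * 'X).
  by apply: eq_bigr => l /negPf lj; rewrite !ffunE lj.
rewrite !same !ffunE eqxx !linearP /=.
set P := \prod_(l | _) _.
rewrite -[RHS]/(a * (_ : {poly A})`_i + _) -coefCM -coefD mulrA -mulrDl.
congr ((_ * _) : {poly A})`_i.
rewrite -[a *: eu x]/(a * eu x) -[a *: h x]/(a * h x) !rmorphD !rmorphM /=.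
by rewrite mulrDr mulrDl addrACA mulrA.
Qed.

Lemma ftheta_sym i : symfun (ftheta ^~ i).
Proof.
move=> t s; rewrite /ftheta [in RHS](reindex_inj (@perm_inj _ s)) /=.
by congr (polyseq _)`_i; apply: eq_bigr => j _; rewrite !ffunE.
Qed.

Lemma theta_exists i : exists g : dual N, forall t, g (sgen gA t) = ftheta t i.
Proof.
have [phi phiE] := sgen_lift gA (ftheta_multilin i) (ftheta_sym i).
by have [g gE] := linear_dual phi; exists g => t; rewrite gE phiE.
Qed.

Definition theta i : dual N := projT1 (cid (theta_exists i)).

Lemma thetaE i t : theta i (sgen gA t) = ftheta t i.
Proof. by rewrite /theta; case: cid. Qed.

Definition smono i : N := sgen gA (mono q d w i).

(** Up to the factor [u ^ q], the families [theta] and [smono] are dual bases. *)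
Lemma theta_mono i j : (j <= q)%N -> theta i (smono j) = u ^+ q * (i == j)%:R.
Proof.
move=> jq; rewrite thetaE /ftheta.
have -> : \prod_l ((h (mono q d w j l))%:P + (eu (mono q d w j l))%:P * 'X) =
    \prod_(l < q) (if (l < j)%N then u%:P * 'X else u%:P).
  apply: eq_bigr => l _; rewrite ffunE; case: ifP => _.
    by rewrite h_d eu_d polyC0 add0r.
  by rewrite h_w eu_w polyC0 mul0r addr0.
rewrite prod_if_lt // exprMn -mulrA (mulrC 'X^j) mulrA -exprD subnKC //.
by rewrite -polyC_exp coefCM coefXn.
Qed.

Lemma theta_basis (g : dual N) :
  u ^+ q *: g = \sum_(i < q.+1) g (smono i) *: theta i.
Proof.
apply: dual_ext => n; move: n; apply: sgen_ext => t.
have := chart_form t (sgen_multilin g) (sgen_sym g).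
rewrite /= dual_sumE => gE.
rewrite -[LHS]/(u ^+ q *: g (sgen gA t)) gE; apply: eq_bigr => i _.
by rewrite dualZE thetaE mulrC.
Qed.

(** Obtained by applying [s] to the expansion of [u ^ q *: g] in [theta_basis]: the double dual is
    described on the chart directly, without a description of the symmetric power. *)
Lemma smono_basis (s : dual (dual N)) :
  u ^+ q *: s = \sum_(i < q.+1) s (theta i) *: eval (smono i).
Proof.
apply: dual_ext => g; rewrite dualZE dual_sumE.
rewrite -dual_appZ theta_basis linear_sum; apply: eq_bigr => i _.
by rewrite -[LHS]/(s (_ *: _)) dual_appZ mulrC.
Qed.

Lemma smono_pairing (phi : {linear dual (dual N) -> A^o}) (s : dual (dual N)) :
  u ^+ q * phi s = \sum_(i < q.+1) s (theta i) * phi (eval (smono i)).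
Proof.
have -> : u ^+ q * phi s = phi (u ^+ q *: s) by rewrite linearZ.
by rewrite smono_basis linear_sum; apply: eq_bigr => i _; rewrite linearZ.
Qed.

End Degree.
End Chart.

(* Cayley-Hamilton gives a monic polynomial killing [B]; as a column of [B]
   vanishes, its constant term does too, and regularity lowers the degree. *)
Lemma zero_col_left_kernel (A : comNzRingType) m (B : 'M[A]_m.+1) j :
  col j B = 0 -> exists2 c : 'rV_m.+1, c != 0 & c *m B = 0.
Proof.
move=> Bj; apply: contrapT => noker.
have ker0 (c : 'rV_m.+1) : c *m B = 0 -> c = 0.
  by move=> cB; apply/eqP/negPn/negP => c0; apply: noker; exists c.
suff nomonic (p : {poly A}) : p \is monic -> horner_mx B p <> 0.
  exact: nomonic (char_poly_monic B) (Cayley_Hamilton B).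
elim/poly_ind: p => [|p c IHp]; first by rewrite monicE lead_coef0 eq_sym oner_eq0.
move=> pXc; rewrite rmorphD rmorphM /= horner_mx_X horner_mx_C => pB0.
have c0 : c = 0.
  move/matrixP/(_ j j): pB0; rewrite !mxE eqxx mulr1n big1 ?add0r // => i _.
  by move/colP/(_ i): Bj; rewrite !mxE => ->; rewrite mulr0.
have pm : p \is monic by move: pXc; rewrite c0 addr0 monicE lead_coefMX -monicE.
apply: (IHp pm); apply/row_matrixP => i; rewrite row0; apply: ker0.
by rewrite -row_mul mulmxE; move: pB0; rewrite c0 raddf0 addr0 => ->; rewrite row0.
Qed.

(** Zero columns are added to make the matrix square. This bounds ranks over a ring that has not
    been shown to be a domain. *)
Lemma wide_left_kernel (A : comNzRingType) m n (B : 'M[A]_(m, n)) : (n < m)%N ->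
  exists2 c : 'rV_m, c != 0 & c *m B = 0.
Proof.
case: m B => // m B; rewrite ltnS => nm.
pose C : 'M[A]_m.+1 := \matrix_(i, j)
  if insub (val j) is Some k then B i k else 0.
have [|c c0 cC] := @zero_col_left_kernel A m C ord_max.
  by apply/colP => i; rewrite !mxE insubF // ltnNge nm.
exists c => //; apply/rowP => k.
have km : (k < m.+1)%N by rewrite (leq_trans (ltn_ord k)) // (leq_trans nm).
move/rowP/(_ (Ordinal km)): cC; rewrite !mxE => {2}<-; apply: eq_bigr => i _.
by rewrite mxE insubT //= => kn; congr (_ * B _ _); apply/val_inj.
Qed.

(** The [theta] separate the [q + 1] monomials, which are therefore independent. Conversely, a
    linear relation between the values of elements on the [theta] is one between the elements
    themselves, [u] being regular. *)
Lemma chart_rank (A : comNzRingType) (gA : int -> set A) (E : gmod A)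
    (eu h : {linear E -> A^o}) (d w : E) (u : A) (q : nat) :
  (forall e, u *: e = eu e *: d + h e *: w) ->
  eu d = u -> eu w = 0 -> h d = 0 -> h w = u ->
  (forall a, u * a = 0 -> a = 0) ->
  is_rank (gbidual gA (gsym gA q E)) q.+1.
Proof.
move=> chartE eu_d eu_w h_d h_w u_reg.
have uq_reg a : u ^+ q * a = 0 -> a = 0.
  by elim: (q) => [|i IHi]; rewrite ?mul1r // exprS -mulrA => /u_reg.
pose th i := @theta _ gA _ eu h q i : dual (gsym gA q E).
pose mo i := @smono _ gA _ d w q i.
split=> [|m [v indep]].
  exists (fun i => eval (mo i)) => c c0 j; apply: uq_reg.
  have : (\sum_(i < q.+1) c i *: eval (mo i)) (th j) = 0 by rewrite c0.
  rewrite dual_sumE (bigD1 j) //= big1 ?addr0.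
    rewrite -[LHS]/(c j * th j (mo j)) (theta_mono gA eu_d eu_w h_d h_w) -1?ltnS //.
    by rewrite eqxx mulr1 mulrC.
  move=> i /negPf ij; rewrite -[LHS]/(c i * th j (mo i)).
  rewrite (theta_mono gA eu_d eu_w h_d h_w) -1?ltnS //.
  by rewrite val_eqE eq_sym ij !mulr0.
rewrite leqNgt; apply/negP => qm.
pose V : 'M[A]_(m, q.+1) := \matrix_(i, j) (v i) (th j).
have [c /eqP c0 cB] := wide_left_kernel V qm.
apply: c0; apply/rowP => i; rewrite mxE; apply: (indep (fun i => c 0 i)).
set s := \sum_(i < m) _; apply: dual_ext => g; apply: uq_reg.
rewrite -[LHS]/((u ^+ q *: s) g) (smono_basis chartE) dual_sumE.
rewrite big1 // => k _; rewrite -[LHS]/(s (th k) * g (mo k)) /s dual_sumE.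
move/rowP/(_ k): cB; rewrite !mxE => cB.
rewrite (eq_bigr (fun i => c 0 i * V i k)) ?cB ?mul0r //.
by move=> l _; rewrite mxE.
Qed.

(** * Substitution in monomials and contraction of forms *)

Lemma size_coef_linear_exp (A : comNzRingType) (a b : A) l :
  let P := (b%:P + a%:P * 'X) ^+ l in (size P <= l.+1)%N /\ P`_l = a ^+ l.
Proof.
set L := b%:P + a%:P * 'X.
elim: l => [|l [szP Pl]] /=; first by rewrite expr0 size_poly1 coef1.
have -> : L ^+ l.+1 = b *: L ^+ l + a *: (L ^+ l * 'X).
  by rewrite exprS {1}/L mulrDl -!mul_polyC -mulrA (mulrC 'X).
split; last by rewrite coefD !coefZ coefMX /= Pl nth_default ?mulr0 ?add0r ?exprS.
rewrite (leq_trans (size_polyD _ _)) // geq_max.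
apply/andP; split; apply: leq_trans (size_scale_leq _ _) _; first exact: leqW.
by rewrite (leq_trans (size_polyMleq _ _)) // size_polyX addn2.
Qed.

(** A case of [multilin_expand]: the first [l] slots hold [a x + b y], and each of the others holds
    [y] and contributes the factor 1 to the product. *)
Lemma mono_subst (A : comNzRingType) (M V : lmodType A) m
    (G : {ffun 'I_m -> M} -> V) (x y : M) (a b : A) l :
  multilin G -> symfun G -> (l <= m)%N ->
  G (mono m (a *: x + b *: y) y l) =
  \sum_(i < m.+1) ((b%:P + a%:P * 'X) ^+ l)`_i *: G (mono m x y i).
Proof.
move=> mG sG lm.
have -> : mono m (a *: x + b *: y) y l =
    [ffun j : 'I_m => (if (j < l)%N then a else 0) *: x
                      + (if (j < l)%N then b else 1) *: y].
  by apply/ffunP => j; rewrite !ffunE; case: ifP; rewrite ?scale0r ?add0r ?scale1r.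
have -> : (b%:P + a%:P * 'X) ^+ l =
    \prod_(j < m) (if (j < l)%N then b%:P + a%:P * 'X else 1).
  by rewrite prod_if_lt // expr1n mulr1.
rewrite multilin_expand //; apply: eq_bigr => i _; congr ((polyseq _)`_i *: _).
by apply: eq_bigr => j _; case: ifP; rewrite // polyC0 mul0r addr0.
Qed.

Lemma mono_scale (A : comNzRingType) (M V : lmodType A) m
    (G : {ffun 'I_m -> M} -> V) (x y : M) (a : A) l :
  multilin G -> symfun G -> (l <= m)%N ->
  G (mono m (a *: x) y l) = a ^+ l *: G (mono m x y l).
Proof.
move=> mG sG lm; have := mono_subst x y a 0 mG sG lm.
rewrite scale0r addr0 => ->.
rewrite (bigD1 (Ordinal (lm : (l < m.+1)%N))) //= big1 ?addr0.
  by have /= [_ ->] := size_coef_linear_exp a 0 l.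
move=> i; rewrite -val_eqE /= => /negPf il; rewrite polyC0 add0r exprMn.
by rewrite -rmorphXn coefCM coefXn il mulr0 scale0r.
Qed.

(** The product is itself a symmetric multilinear function, so [multilin_expand] applies with the
    vectors [Y] and [u]: the right side is the binary form with the given coefficients evaluated at
    them. *)
Lemma homogenized_prod (A : comNzRingType) q (a b : 'I_q -> A) (u : A) (Y : {poly A}) :
  \prod_j ((u * b j)%:P + (a j)%:P * Y) =
  \sum_(i < q.+1)
    (\prod_j ((b j)%:P + (a j)%:P * 'X))`_i *: (u%:P ^+ (q - i) * Y ^+ i).
Proof.
pose G (t : {ffun 'I_q -> {poly A}}) := \prod_j t j.
have mG : multilin G.
  move=> t i c x y; rewrite /G !(bigD1 i (P := xpredT)) //= !ffunE eqxx.
  have same z : \prod_(l | l != i) upd t i z l = \prod_(l | l != i) t l.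
    by apply: eq_bigr => l /negPf li; rewrite !ffunE li.
  by rewrite !same mulrDl scalerAl.
have sG : symfun G.
  move=> t s; rewrite /G [in RHS](reindex_inj (@perm_inj _ s)) /=.
  by apply: eq_bigr => j _; rewrite !ffunE.
have := multilin_expand mG sG a b Y u%:P.
rewrite /G => expand; transitivity (\prod_j [ffun j => a j *: Y + b j *: u%:P] j).
  by apply: eq_bigr => j _; rewrite ffunE -!mul_polyC -polyCM addrC (mulrC u).
rewrite expand; apply: eq_bigr => i _; congr (_ *: _).
rewrite mulrC -prod_if_lt -1?ltnS //.
by apply: eq_bigr => j _; rewrite ffunE.
Qed.

Section Cons.
Variables (A : comNzRingType) (gA : int -> set A) (E : gmod A) (m : nat).

Definition fcons (e : E) (t : {ffun 'I_m -> E}) : {ffun 'I_m.+1 -> E} :=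
  [ffun j => if unlift ord0 j is Some k then t k else e].

Lemma fcons_upd e t i x : fcons e (upd t i x) = upd (fcons e t) (lift ord0 i) x.
Proof.
apply/ffunP => j; rewrite !ffunE; case: unliftP => [k ->|->].
  by rewrite ffunE (inj_eq lift_inj).
by rewrite (negPf (neq_lift _ _)).
Qed.

Lemma fcons_head e t x : fcons x t = upd (fcons e t) ord0 x.
Proof.
apply/ffunP => j; rewrite !ffunE; case: unliftP => [k ->|->].
  by rewrite eq_sym (negPf (neq_lift _ _)).
by rewrite eqxx.
Qed.

Lemma fcons_mono_r x y i : (i <= m)%N ->
  exists s : {perm 'I_m.+1}, fcons y (mono m x y i) = [ffun j => mono m.+1 x y i (s j)].
Proof.
move=> im; pose io : 'I_m.+1 := Ordinal (im : (i < m.+1)%N).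
exists (tperm ord0 io); apply/ffunP => j; rewrite !ffunE.
case: tpermP => [->|->|/eqP j0 /eqP ji].
- by rewrite unlift_none /= ltnn.
- case: unliftP => [k kE|iE]; rewrite ?ffunE /=.
    have -> : i = k.+1 by rewrite -[LHS]/(val io) kE.
    by rewrite ltnSn.
  by rewrite -[i]/(val io) iE ltnn.
- case: unliftP => [k kE|j0']; last by rewrite j0' eqxx in j0.
  rewrite ffunE kE lift0 [in RHS]ltn_neqAle; move: ji.
  by rewrite kE -val_eqE /= /bump /= add1n => /negPf ->.
Qed.

Section Form.
Variable (V : lmodType A) (phi : {linear gsym gA m.+1 E -> V}).

(** For [phi] on Sym^(m+1) this is [t |-> phi (e t)], the contraction of [phi] by [e]. *)
Definition cons_form (e : E) (t : {ffun 'I_m -> E}) := phi (sgen gA (fcons e t)).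

Lemma cons_form_multilin e : multilin (cons_form e).
Proof.
move=> t i a x y; rewrite /cons_form !fcons_upd.
exact: (sgen_multilin phi).
Qed.

Lemma cons_form_sym e : symfun (cons_form e).
Proof.
move=> t s; rewrite /cons_form.
rewrite -[RHS](sgen_sym phi _ (lift_perm ord0 ord0 s)) /=; congr (phi (sgen gA _)).
apply/ffunP => j; rewrite !ffunE; case: unliftP => [k ->|->].
  by rewrite lift_perm_lift liftK ffunE.
by rewrite lift_perm_id unlift_none.
Qed.

Lemma cons_form_linear t : linear (cons_form ^~ t).
Proof.
move=> a x y; rewrite /cons_form (fcons_head 0) (fcons_head 0 _ x) (fcons_head 0 _ y).
exact: (sgen_multilin phi).
Qed.

Lemma cons_form_mono_r x y i : (i <= m)%N ->
  cons_form y (mono m x y i) = phi (sgen gA (mono m.+1 x y i)).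
Proof.
move=> /(fcons_mono_r x y)[s]; rewrite /cons_form => ->.
exact: (sgen_sym phi).
Qed.

End Form.
End Cons.

(** [u] is regular modulo [v], hence modulo [v ^ n] by induction on [n], and then so is [u ^ m].
    Sections over the two charts are glued in this form. *)
Lemma regular_pow_dvd (A : comPzRingType) (u v : A) :
  (forall a, v * a = 0 -> a = 0) ->
  (forall a b, u * a = v * b -> exists c, a = v * c) ->
  forall m n a b, u ^+ m * a = v ^+ n * b -> exists c, a = v ^+ n * c.
Proof.
move=> v_reg uv_reg.
have one n : forall a b, u * a = v ^+ n * b -> exists c, a = v ^+ n * c.
  elim: n => [|n IHn] a b; first by exists a; rewrite mul1r.
  rewrite exprS -mulrA => uavb; have [c ac] := uv_reg _ _ uavb.
  have /IHn[c' cc'] : u * c = v ^+ n * b.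
    apply/eqP; rewrite -subr_eq0; apply/eqP/v_reg.
    by rewrite mulrBr -uavb ac mulrCA subrr.
  by exists c'; rewrite ac cc' mulrA.
elim=> [|m IHm] n a b; first by rewrite mul1r => ->; exists b.
by rewrite exprS -mulrA => /one[c /IHm].
Qed.

Lemma reg_pow_inj (A : comPzRingType) (x : A) n : (forall a, x * a = 0 -> a = 0) ->
  forall a b, x ^+ n * a = x ^+ n * b -> a = b.
Proof.
move=> x_reg a b ab; apply/eqP; rewrite -subr_eq0; apply/eqP.
have : x ^+ n * (a - b) = 0 by rewrite mulrBr ab subrr.
by elim: n {ab} => [|n IHn]; rewrite ?mul1r // exprS -mulrA => /x_reg.
Qed.

(** * Pairings on an extension of O by O *)

Section TwoCharts.
Variables (A : comNzRingType) (gA : int -> set A) (E : gmod A).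
Variables (eu hu hv : {linear E -> A^o}) (w du dv : E) (u v g : A).
Hypothesis chart_u : forall e, u *: e = eu e *: du + hu e *: w.
(* The Cech cocycle of the extension is [g / (u * v)]. *)
Hypothesis change_d : v *: du = u *: dv + g *: w.
Hypothesis change_h : forall e, v * hu e = u * hv e - g * eu e.
Hypothesis u_reg : forall a, u * a = 0 -> a = 0.
Hypothesis vu_reg : forall a b, v * a = u * b -> exists c, a = u * c.
Variable q : nat.
Local Notation N := (gsym gA q E).
Implicit Types (s : dual (dual N)) (phi : {linear dual (dual N) -> A^o}).

Local Notation thu := (@theta A gA E eu hu q).
Local Notation thv := (@theta A gA E eu hv q).
Local Notation mou := (@smono A gA E du w q).
Local Notation mov := (@smono A gA E dv w q).

(** Only products of linear terms reach degree [q], so [hu] drops out and the functional is the same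
    in both charts: it is the projection of Sym^q E onto Sym^q (E / O w). *)
Lemma theta_top t : thu q (sgen gA t) = \prod_j eu (t j).
Proof.
rewrite thetaE /ftheta.
have : forall (I : Type) (r : seq I) (a b : I -> A),
  let P := \prod_(j <- r) ((b j)%:P + (a j)%:P * 'X) in
  (size P <= (size r).+1)%N /\ P`_(size r) = \prod_(j <- r) a j.
  move=> I r a b /=; elim: r => [|x r [szP IHr]].
    by rewrite !big_nil size_poly1 coef1.
  rewrite !big_cons mulrDl -mulrA (mulrC 'X) -IHr; set P := \prod_(j <- r) _ in szP *.
  rewrite coefD !coefCM coefMX /= nth_default // mulr0 add0r; split=> //.
  rewrite (leq_trans (size_polyD _ _)) // geq_max !mul_polyC.
  apply/andP; split; apply: leq_trans (size_scale_leq _ _) _; first exact: leqW.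
  by rewrite (leq_trans (size_polyMleq _ _)) // size_polyX addn2.
move=> /(_ _ (enum 'I_q) (eu \o t) (hu \o t))[_].
by rewrite size_enum_ord !big_enum.
Qed.

(** By [change_h], [v (hu + eu X) = u hv + eu (v X - g)]; the product of these factors is expanded
    in [u] and [v X - g] by [homogenized_prod]. *)
Lemma change_theta i :
  v ^+ q *: thu i = \sum_(l < q.+1)
    (((- g)%:P + v%:P * 'X) ^+ l)`_i * u ^+ (q - l) *: thv l.
Proof.
apply: dual_ext => n; move: n; apply: sgen_ext => t.
rewrite /= dual_sumE -[LHS]/(v ^+ q * thu i (sgen gA t)) thetaE /ftheta.
transitivity (\sum_(l < q.+1)
    (((- g)%:P + v%:P * 'X) ^+ l)`_i * u ^+ (q - l) * ftheta eu hv t l); last first.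
  by apply: eq_bigr => l _; rewrite -[RHS]/(_ * thv l (sgen gA t)) thetaE.
rewrite -coefCM polyC_exp.
have -> : v%:P ^+ q = \prod_(j < q) v%:P by rewrite prodr_const card_ord.
rewrite -big_split /=.
rewrite (eq_bigr (fun j => (u * hv (t j))%:P + (eu (t j))%:P * ((- g)%:P + v%:P * 'X))).
  rewrite homogenized_prod coef_sum; apply: eq_bigr => l _.
  rewrite coefZ -polyC_exp coefCM mulrC; congr (_ * _).
  by rewrite mulrC.
move=> j _; rewrite mulrDr -polyCM change_h polyCB !polyCM polyCN; ring.
Qed.

(* Up to the factors [u ^+ q] and [v ^+ q], both [au e] and [av e] are the pairing of [phi]
   with [e * (s / w)]; regularity of [v, u] makes [au e] divisible by [u ^+ q]. *)
Lemma vanishing_top_pairing s phi :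
  s (thu q) = 0 -> s (thv q) = 0 -> exists a b, g * phi s = v * a - u * b.
Proof.
move=> sthu sthv.
have pair_u : u ^+ q * phi s = \sum_(i < q) s (thu i) * phi (eval (mou i)).
  by rewrite (smono_pairing chart_u) big_ord_recr /= sthu mul0r addr0.
have sth i : v ^+ q * s (thu i) = \sum_(l < q)
    (((- g)%:P + v%:P * 'X) ^+ l)`_i * u ^+ (q - l) * s (thv l).
  rewrite -dual_appZ change_theta linear_sum big_ord_recr /=.
  rewrite linearZ /= sthv scaler0 addr0; apply: eq_bigr => l _.
  by rewrite -[LHS]/(s (_ *: _)) dual_appZ.
(* For [q = 0] there is no factor [w] to divide by, but then the pairing is an empty sum. *)
case: q phi s sthu sthv pair_u sth => [|m] phi s sthu sthv pair_u sth.
  exists 0, 0; move: pair_u; rewrite big_ord0 mul1r => ->.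
  by rewrite !mulr0 subrr.
pose psi : {linear gsym gA m.+1 E -> A^o} := phi \o @eval A (gsym gA m.+1 E).
pose G e := cons_form psi e.
pose au e := \sum_(i < m.+1) s (theta gA eu hu m.+1 i) * G e (mono m du w i).
pose av e := \sum_(i < m.+1) s (theta gA eu hv m.+1 i) * G e (mono m dv w i).
(* The coefficients of [s] and the monomials in [du], [dv] change by transposed rules under the one
   substitution [u dv = v du - g w]. *)
have auv e : v ^+ m.+1 * au e = u ^+ m.+1 * av e.
  have mG := cons_form_multilin psi e; have sG := cons_form_sym psi e.
  rewrite /au mulr_sumr; under eq_bigr do rewrite mulrA sth mulr_suml.
  rewrite exchange_big /= /av mulr_sumr; apply: eq_bigr => l _.
  have lm : (l <= m)%N by rewrite -ltnS.
  have := mono_subst du w v (- g) mG sG lm.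
  have -> : v *: du + - g *: w = u *: dv by rewrite change_d scaleNr addrK.
  rewrite mono_scale // => GE.
  transitivity (u ^+ (m.+1 - l) * s (theta gA eu hv m.+1 l)
                * (u ^+ l *: G e (mono m dv w l))).
    rewrite GE mulr_sumr; apply: eq_bigr => i _.
    rewrite -[X in _ = _ * X]/(_ * _) /G; ring.
  rewrite -[X in _ * X]/(u ^+ l * _).
  have -> : u ^+ m.+1 = u ^+ (m.+1 - l) * u ^+ l.
    by rewrite -exprD subnK // ltnW.
  exact: mulrACA.
have auE (a : A) x y : au (a *: x + y) = a * au x + au y.
  rewrite /au mulr_sumr -big_split; apply: eq_bigr => i _ /=.
  rewrite /G (cons_form_linear psi) -[X in _ * (X + _) = _]/(_ * _) ; ring.
have au0 : au 0 = 0.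
  by have := auE (-1) 0 0; rewrite scaler0 addr0 mulN1r addNr.
have [p pE] := regular_pow_dvd u_reg vu_reg (auv du).
have [r rE] := regular_pow_dvd u_reg vu_reg (auv dv).
(* Taking [e = w] restores the factor divided out, and with it the pairing of [phi] with [s]. *)
have auw : au w = u ^+ m.+1 * phi s.
  rewrite pair_u /au; apply: eq_bigr => i _; rewrite /G cons_form_mono_r //.
  by rewrite -ltnS.
exists p, r; apply: (reg_pow_inj (n := m.+1) u_reg).
(* The linear function [au] is evaluated on both sides of [change_d]; cancelling [u ^ m.+1] leaves
   the relation sought. *)
have : au (v *: du + 0) = au (u *: dv + (g *: w + 0)) by rewrite !addr0 change_d.
rewrite !auE au0 !addr0 auw pE rE => rel.
have -> : u ^+ m.+1 * (g * phi s) = g * (u ^+ m.+1 * phi s) by ring.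
have -> : g * (u ^+ m.+1 * phi s) = v * (u ^+ m.+1 * p) - u * (u ^+ m.+1 * r).
  by rewrite rel addrAC subrr add0r.
ring.
Qed.

(* If [phi] lowers degrees, its values on [w ^ (q - l) du ^ l] vanish by induction on [l]:
   the first nonzero one would be divisible by [u ^+ l], with a quotient of negative
   degree. *)
Lemma negative_pairing s phi :
  (forall l x, (l <= q)%N ->
     phi (eval (mou l)) = u ^+ l * x -> phi (eval (mou l)) = 0) ->
  phi s = 0.
Proof.
move=> deg.
suff cu0 l : (l <= q)%N -> phi (eval (mou l)) = 0.
  apply: (reg_pow_inj (n := q) u_reg).
  rewrite mulr0 (smono_pairing chart_u) big1 // => i _.
  by rewrite cu0 ?mulr0 // -ltnS.
elim/ltn_ind: l => l IHl lq.
pose psi : {linear N -> A^o} := phi \o @eval A N.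
have mpsi := sgen_multilin psi; have spsi := sgen_sym psi.
have := mono_subst du w v (- g) mpsi spsi lq.
have -> : v *: du + - g *: w = u *: dv.
  by rewrite change_d scaleNr addrK.
rewrite mono_scale // (bigD1 (Ordinal (lq : (l < q.+1)%N))) //= big1 ?addr0.
  have /= [_ ->] := size_coef_linear_exp v (- g) l.
  move=> uv; have [|x xE] := @regular_pow_dvd A v u u_reg vu_reg l l
    (phi (eval (mou l))) (phi (eval (mov l))).
    exact: esym.
  exact: deg lq xE.
move=> i; rewrite -val_eqE /= => il.
have [li|li|li] := ltngtP (i : nat) l; last by rewrite li eqxx in il.
  by rewrite [X in _ *: X]IHl ?scaler0 // (leq_trans _ lq) // ltnW.
rewrite nth_default ?scale0r //.
by have /= [sz _] := size_coef_linear_exp v (- g) l; exact: leq_trans li.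
Qed.

End TwoCharts.

(** * The bound on the graded free rank *)

Section FreeRank.
Variables (A : comNzRingType) (gA : int -> set A) (E : gmod A).
Variables (eu hu hv : {linear E -> A^o}) (w du dv : E) (u v g : A).
Hypothesis chart_u : forall e, u *: e = eu e *: du + hu e *: w.
Hypothesis change_d : v *: du = u *: dv + g *: w.
Hypothesis change_h : forall e, v * hu e = u * hv e - g * eu e.
Hypothesis u_reg : forall a, u * a = 0 -> a = 0.
Hypothesis vu_reg : forall a b, v * a = u * b -> exists c, a = u * c.

Hypothesis gA0 : forall i, gA i 0.
Hypothesis gAB : forall i a b, gA i a -> gA i b -> gA i (a - b).
Hypothesis gA1 : gA 0 1.
Hypothesis gAM : forall i j a b, gA i a -> gA j b -> gA (i + j) (a * b).
Hypothesis gA_neg : forall i a, i < 0 -> gA i a -> a = 0.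
Hypothesis gA_div : forall i (l : nat) a, gA (i + l%:Z) (u ^+ l * a) -> gA i a.
Hypothesis g_const : forall c a b, gA 0 c -> g * c = v * a - u * b -> c = 0.
Hypothesis eu_deg : forall i e, gdeg i e -> gA i (eu e).
Hypotheses (w_deg : gdeg 0 w) (du_deg : gdeg 1 du).
Variable q : nat.
Local Notation N := (gsym gA q E).
Local Notation M := (gbidual gA N).
Local Notation thu := (@theta A gA E eu hu q).
Local Notation thv := (@theta A gA E eu hv q).
Local Notation mou := (@smono A gA E du w q).

Lemma prod_deg n (a : 'I_n -> A) (d : 'I_n -> int) :
  (forall i, gA (d i) (a i)) -> gA (\sum_(i < n) d i) (\prod_(i < n) a i).
Proof.
elim: n a d => [|n IHn] a d ad; first by rewrite !big_ord0.
by rewrite !big_ord_recl; apply: gAM => //; apply: IHn.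
Qed.

Lemma theta_top_deg : @gdeg A (gdual gA N) 0 (thu q).
Proof.
move=> j m; rewrite add0r => jm.
apply: (jm [set m | gA j (thu q m)]).
split=> [|_ [i [l [a [t [-> ai [dt [-> td]] ->]]]]]] /=.
  split=> [|x y /= xj yj]; first by rewrite linear0.
  by rewrite linearB; apply: gAB.
rewrite -[thu q _]/(thu q (a *: sgen gA t)) dual_appZ theta_top; apply: gAM => //.
by apply: prod_deg => k; apply: eu_deg.
Qed.

Lemma smono_deg l : (l <= q)%N -> @gdeg A N l%:Z (mou l).
Proof.
move=> lq; rewrite /gsym /presented /= => W [_]; apply; exists 0, l%:Z, 1, (mono q du w l).
split; rewrite ?add0r ?scale1r //.
exists (fun i : 'I_q => if (i < l)%N then 1 else 0); split.
  rewrite -big_mkcond /= -(big_ord_widen q (fun=> 1 : int) lq).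
  by rewrite sumr_const card_ord natz.
by move=> i; rewrite ffunE; case: ifP.
Qed.

Lemma eval_deg i (n : N) : gdeg i n -> @gdeg A M i (eval n).
Proof. by move=> ni j psi psij; rewrite addrC; apply: psij. Qed.

Lemma theta_top_eq : thu q = thv q.
Proof.
apply: dual_ext => n; move: n; apply: sgen_ext => t.
by rewrite -[LHS]/(thu q (sgen gA t)) -[RHS]/(thv q (sgen gA t)) !theta_top.
Qed.

Lemma coord_linear n (a : 'I_n -> int) (phi : {linear M -> gfree gA a}) i :
  linear (fun m => (phi m : 'rV[A]_n) ord0 i : A^o).
Proof. by move=> c x y; rewrite linearP !mxE. Qed.

(** If [a i < 0], the [i]-th coordinate of [phi] lowers degrees and vanishes by [negative_pairing],
    although it takes the value 1 on the [i]-th basis vector of the summand. *)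
Lemma split_degree n (a : 'I_n -> int) (phi : {linear M -> gfree gA a})
    (sec : {linear gfree gA a -> M}) i :
  homog0 phi -> homog0 sec -> cancel sec phi -> 0 <= a i.
Proof.
move=> phi0 sec0 phiK; rewrite leNgt; apply/negP => ai.
pose phi_i : {linear dual (dual N) -> A^o} :=
  HB.pack (fun m : dual (dual N) => (phi m : 'rV[A]_n) ord0 i : A^o)
    (GRing.isLinear.Build _ _ _ _ _ (coord_linear phi i)).
have : phi_i (sec (delta_mx 0 i)) = 1.
  by rewrite -[LHS]/((phi (sec _) : 'rV[A]_n) ord0 i) phiK mxE !eqxx.
apply/eqP; rewrite (negative_pairing chart_u change_d u_reg vu_reg).
  by rewrite eq_sym oner_eq0.
move=> l x lq mx.
have := phi0 l (eval (mou l)) (eval_deg (smono_deg lq)) i.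
rewrite -[(phi _ : 'rV[A]_n) ord0 i]/(phi_i _) mx => /gA_div /(gA_neg ai) ->.
by rewrite mulr0.
Qed.

Lemma frk_le1 n : splits_free gA M n -> (n <= 1)%N.
Proof.
case: n => [|[|n]] // [a [phi [sec [phi0 sec0 phiK]]]].
pose p (i : 'I_n.+2) : {linear dual (dual N) -> A^o} :=
  HB.pack (fun m : dual (dual N) => (phi m : 'rV[A]_n.+2) ord0 i : A^o)
    (GRing.isLinear.Build _ _ _ _ _ (coord_linear phi i)).
pose s i : dual (dual N) := sec (delta_mx 0 i).
have ps i j : p i (s j) = (i == j)%:R.
  by rewrite -[LHS]/((phi (sec _) : 'rV[A]_n.+2) ord0 i) phiK mxE eqxx eq_sym.
(* This value has degree [- a i] with [a i >= 0]: it is of degree 0 if [a i = 0], and zero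
   otherwise. *)
have tau0 i : gA 0 (s i (thu q)).
  have si_deg : @gdeg A M (- a i) (s i).
    apply: sec0 => j; rewrite mxE eqxx /=; case: eqP => [->|_] //.
    by rewrite subrr.
  have := si_deg 0 (thu q) theta_top_deg; rewrite addr0.
  have := split_degree i phi0 sec0 phiK.
  rewrite le_eqVlt => /orP[/eqP <-|ai]; first by rewrite oppr0.
  by move=> /gA_neg ->; rewrite ?oppr_lt0.
have pairing (r : dual (dual N)) i : r (thu q) = 0 ->
    exists x y, g * p i r = v * x - u * y.
  move=> r0; apply: (vanishing_top_pairing chart_u change_d change_h u_reg vu_reg) => //.
  by rewrite -theta_top_eq.
(* A vanishing value would put [g] itself in the ideal of [u] and [v]. *)
have tau_neq0 i : s i (thu q) <> 0.
  move=> /(pairing _ i)[x [y]]; rewrite ps eqxx => /(g_const gA1)/eqP.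
  by rewrite oner_eq0.
pose i0 : 'I_n.+2 := ord0; pose i1 : 'I_n.+2 := ord_max.
(* The top coefficient of [r] cancels, whereas [p i1 r] is the nonzero top coefficient of [s i0]. *)
pose r := s i0 (thu q) *: s i1 + (- s i1 (thu q)) *: s i0.
have /(pairing _ i1)[x [y]] : r (thu q) = 0.
  by rewrite dualDE !dualZE mulNr mulrC subrr.
have -> : p i1 r = s i0 (thu q) * p i1 (s i1) + - s i1 (thu q) * p i1 (s i0).
  by rewrite linearD !linearZ.
by rewrite !ps eqxx mulr1 mulr0 addr0 => /(g_const (tau0 i0))/tau_neq0.
Qed.

End FreeRank.

(** * Homogeneous polynomials and elimination *)

Lemma ord3_ind (P : 'I_3 -> Prop) :
  P (inord 0) -> P (inord 1) -> P (inord 2) -> forall i, P i.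
Proof.
move=> P0 P1 P2 i; rewrite -[i]inord_val.
by case: (i : nat) (ltn_ord i) => [|[|[|]]].
Qed.


Section MPolyMorphisms.
Variables (n : nat) (k : comNzRingType).

Lemma mpoly_ring_ind (P : mpoly n k -> Prop) :
  (forall c, P (mpolyC n c)) -> (forall i, P (mX i)) ->
  (forall p q, P p -> P q -> P (p + q)) ->
  (forall p q, P p -> P q -> P (p * q)) -> forall p, P p.
Proof.
move=> PC PX PD PM p; rewrite [p]mpolyE.
have P0 : P 0 by rewrite -(mpolyC0 n k).
have P1 : P 1 by have := PC 1; rewrite mpolyC1.
apply: (big_ind P P0 PD) => m _; rewrite -mul_mpolyC mpolyXE_id; apply: (PM) => //.
apply: (big_ind P P1 PM) => i _; elim: (m i) => [//|e IHe].
by rewrite exprS; apply: (PM).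
Qed.

Section Congruence.
Variables (T : comNzRingType) (phi psi : {rmorphism mpoly n k -> T}).

(** The polynomials on which the two morphisms agree modulo [l] are closed under sums and products.
    With [l = 0] this gives an equality criterion. *)
Lemma mpoly_rmorph_cong (l : T) :
  (forall c, phi (mpolyC n c) = psi (mpolyC n c)) ->
  (forall i, exists c, phi (mX i) - psi (mX i) = l * c) ->
  forall p, exists c, phi p - psi p = l * c.
Proof.
move=> eqC eqX; apply: mpoly_ring_ind => [c|//|p q [c pE] [d qE]|p q [c pE] [d qE]].
- by exists 0; rewrite eqC subrr mulr0.
- by exists (c + d); rewrite !rmorphD mulrDr -pE -qE /=; ring.
exists (c * phi q + d * psi p); rewrite !rmorphM mulrDr !mulrA -pE -qE /=; ring.
Qed.

Lemma mpoly_rmorph_ext :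
  (forall c, phi (mpolyC n c) = psi (mpolyC n c)) ->
  (forall i, phi (mX i) = psi (mX i)) -> phi =1 psi.
Proof.
move=> eqC eqX p; apply/eqP; rewrite -subr_eq0.
have [|c ->] := mpoly_rmorph_cong (l := 0) eqC _ p; last by rewrite mul0r.
by move=> i; exists 0; rewrite eqX subrr mulr0.
Qed.

End Congruence.

Lemma mmap_homog_scale (T : comNzRingType) (phi : {rmorphism k -> T})
    (h : 'I_n -> T) (c : T) d (p : mpoly n k) : p \is ishomog1 d mdeg ->
  mmap phi (fun i => c * h i) p = c ^+ d * mmap phi h p.
Proof.
move=> /dhomogP homp; rewrite /mmap mulr_sumr big_seq [RHS]big_seq.
apply: eq_bigr => m mp; rewrite mulrCA; congr (_ * _); rewrite /mmap1.
have md : mdeg m = d := homp m mp; rewrite -md mdegE -prodrXr -big_split /=.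
by apply: eq_bigr => i _; rewrite exprMn.
Qed.

Lemma euler_homog d (p : mpoly n k) : p \is ishomog1 d mdeg ->
  \sum_(i < n) mX i * mderiv i p = p *+ d.
Proof.
move=> /dhomogP homp.
transitivity (\sum_(m <- msupp p) mcoeff m p *: mpolyX k m *+ d); last first.
  by rewrite sumrMnl -mpolyE.
rewrite [in LHS](mpolyE p).
under eq_bigr => i _ do rewrite linear_sum mulr_sumr.
rewrite exchange_big /= big_seq [RHS]big_seq; apply: eq_bigr => m mp.
have md : mdeg m = d := homp m mp; rewrite -md mdegE -sumrMnr; apply: eq_bigr => i _.
rewrite linearZ /= mderivX -scalerAr scalerMnr; congr (_ *: _).
rewrite -scalerAr scaler_nat; have [->|mi] := eqVneq (m i) 0%N.
  by rewrite !mulr0n.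
congr (_ *+ _); rewrite -mpolyXD addmC submK //.
by apply/mnm_lepP => j; rewrite mnm1E; case: eqP => [<-|//]; rewrite lt0n.
Qed.

Lemma mderiv_homog d (p : mpoly n k) i :
  p \is ishomog1 d.+1 mdeg -> mderiv i p \is ishomog1 d mdeg.
Proof.
move=> homp; apply/dhomogP => m; rewrite mcoeff_msupp mcoeff_mderiv => mi.
have : mcoeff (mnm_add m (mnm1 i)) p != 0.
  by apply: contraNneq mi => ->; rewrite mul0rn.
rewrite -mcoeff_msupp => /(dhomog_mf homp) /=.
by rewrite mdegD mdeg1 addn1 => -[].
Qed.

Lemma pihomog_mul e (h p : mpoly n k) d : h \is ishomog1 e mdeg ->
  pihomog mdeg (e + d) (h * p) = h * pihomog mdeg d p.
Proof.
move=> homh; set K := maxn (mmeasure mdeg p) d.+1.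
have szp : (mmeasure mdeg p <= K)%N by rewrite leq_maxl.
rewrite {1}(pihomog_partitionE szp) mulr_sumr linear_sum /=.
have dK : (d < K)%N by rewrite leq_max ltnSn orbT.
rewrite (bigD1 (Ordinal dK)) //= pihomog_dE; last exact/dhomogM/pihomogP.
rewrite big1 ?addr0 // => i; rewrite -val_eqE /= => id.
apply: (@pihomog_ne0 _ _ _ (e + i)); last exact/dhomogM/pihomogP.
by rewrite eqn_add2l.
Qed.

Lemma pihomog_mul_lt e (h p : mpoly n k) d : h \is ishomog1 e mdeg -> (d < e)%N ->
  pihomog mdeg d (h * p) = 0.
Proof.
move=> homh de; rewrite {1}(pihomog_partitionE (leqnn (mmeasure mdeg p))).
rewrite mulr_sumr linear_sum /= big1 // => i _.
apply: (@pihomog_ne0 _ _ _ (e + i)); last exact/dhomogM/pihomogP.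
by rewrite gtn_eqF // (leq_trans de) // leq_addr.
Qed.

End MPolyMorphisms.

Lemma top_coef_mul (B : comNzRingType) d e (P Q : {poly B}) :
  (size P <= d.+1)%N -> (size Q <= e.+1)%N ->
  (size (P * Q)%R <= (d + e).+1)%N /\ (P * Q)`_(d + e) = P`_d * Q`_e.
Proof.
move=> szP szQ; split.
  apply: leq_trans (size_polyMleq _ _) _.
  rewrite -subn1 leq_subLR (leq_trans (leq_add szP szQ)) //.
  by rewrite addSn addnS add1n.
rewrite coefM (bigD1 (inord d)) //= inordK ?leq_addr // addKn big1 ?addr0 //.
move=> i; rewrite -val_eqE /= inordK ?ltnS ?leq_addr // => id.
have [lt|lt|E] := ltngtP (i : nat) d; last by rewrite E eqxx in id.
  have le : (e < d + e - i)%N by rewrite ltn_subRL ltn_add2r.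
  by rewrite (nth_default _ (leq_trans szQ le)) mulr0.
by rewrite (nth_default _ (leq_trans szP lt)) mul0r.
Qed.

(** A degree bound together with the coefficient in that degree is multiplicative even when the
    coefficient vanishes, so both can be followed through each monomial. *)
Lemma mmap_linear_top (n : nat) (k B : comNzRingType) (phi : {rmorphism k -> B})
    (a b : 'I_n -> B) d (p : mpoly n k) : p \is ishomog1 d mdeg ->
  let P := mmap (polyC \o phi) (fun i => (b i)%:P + (a i)%:P * 'X) p in
  (size P <= d.+1)%N /\ P`_d = mmap phi a p.
Proof.
move=> /dhomogP homp.
pose top e (P : {poly B}) c := (size P <= e.+1)%N /\ P`_e = c.
have topM e e' P Q c c' : top e P c -> top e' Q c' -> top (e + e')%N (P * Q) (c * c').
  by move=> [szP <-] [szQ <-]; apply: top_coef_mul.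
have topX e P c l : top e P c -> top (l * e)%N (P ^+ l) (c ^+ l).
  move=> tP; elim: l => [|l IHl].
    by split; rewrite ?size_poly1 ?coef1.
  by rewrite mulSn !exprS; apply: (topM).
have top_lin i : top 1%N ((b i)%:P + (a i)%:P * 'X) (a i).
  split; last by rewrite coefD coefC coefCM coefX mulr1 add0r.
  rewrite (leq_trans (size_polyD _ _)) // geq_max (leq_trans (size_polyC_leq1 _)) //.
  by rewrite mul_polyC (leq_trans (size_scale_leq _ _)) // size_polyX.
rewrite /mmap big_seq [X in _ /\ _ = X]big_seq.
apply: (big_ind2 (top d)) => [|P c Q c' [szP Pd] [szQ Qd]|m mp].
- by split; rewrite ?size_poly0 ?coef0.
- split; last by rewrite coefD Pd Qd.
  by rewrite (leq_trans (size_polyD _ _)) // geq_max szP szQ.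
have md : mdeg m = d := homp m mp.
rewrite -md -[mdeg m]add0n; apply: (topM).
  by split; rewrite ?coefC //= size_polyC_leq1.
rewrite mdegE /mmap1.
apply: (big_rec3 (fun P c e => top e P c)) => [|i P c e _ tP].
  by split; rewrite ?size_poly1 ?coef1.
by apply: (topM) tP; rewrite -{1}[m i]muln1; apply: (topX).
Qed.


(* Multiplication by [h] on [B[t]/(F)] is a matrix [H]; as [1 - c h] lies in the ideal,
   so does [det (1 - c H)] by Cramer's rule. *)
Lemma elim_monic (B : comNzRingType) (I : {poly B} -> Prop) (F h : {poly B}) (c : B) :
  (forall p q, I p -> I q -> I (p + q)) -> (forall p q, I p -> I (q * p)) ->
  F \is monic -> I F -> I (1 - c%:P * h) ->
  exists n (H : 'M[B]_n), I (\det (1%:M - c *: H))%:P.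
Proof.
move=> ID IM Fmon IF Ih.
have [szF|szF] := leqP (size F) 1.
  exists 0%N, 1%:M; rewrite det_mx00.
  have [a Fa] : exists a, F = a%:P by exists F`_0; apply: size1_polyC.
  by move: Fmon IF; rewrite Fa monicE lead_coefC => /eqP ->.
pose n := (size F).-1.
have nE : size F = n.+1 by rewrite prednK // ltnW.
pose H : 'M[B]_n := \matrix_(j, l) (Pdiv.Ring.rmodp ('X^j * h) F)`_l.
have rem (j : 'I_n) : I ('X^j * h - \sum_(l < n) (H j l)%:P * 'X^l).
  have -> : \sum_(l < n) (H j l)%:P * 'X^l = Pdiv.Ring.rmodp ('X^j * h) F.
    transitivity (\poly_(l < n) (Pdiv.Ring.rmodp ('X^j * h) F)`_l).
      by rewrite poly_def; apply: eq_bigr => l _; rewrite mxE mul_polyC.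
    apply/polyP => l; rewrite coef_poly; case: ltnP => // nl.
    rewrite nth_default // (leq_trans _ nl) // -ltnS -nE.
    by rewrite Pdiv.Ring.ltn_rmodpN0 ?monic_neq0.
  rewrite {1}(Pdiv.RingMonic.rdivp_eq Fmon ('X^j * h)) addrK.
  exact: (IM).
pose C : 'M[B]_n := 1%:M - c *: H.
have rowC (j : 'I_n) : I (\sum_(l < n) (C j l)%:P * 'X^l).
  have -> : \sum_(l < n) (C j l)%:P * 'X^l =
     'X^j * (1 - c%:P * h) + c%:P * ('X^j * h - \sum_(l < n) (H j l)%:P * 'X^l).
    have -> : \sum_(l < n) (C j l)%:P * 'X^l =
       \sum_(l < n) (j == l)%:R%:P * 'X^l - c%:P * \sum_(l < n) (H j l)%:P * 'X^l.
      rewrite mulr_sumr -sumrB; apply: eq_bigr => l _.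
      by rewrite !mxE polyCB polyCM mulrBl mulrA.
    rewrite (bigD1 j) //= eqxx big1 ?addr0; last first.
      by move=> l /negPf lj; rewrite eq_sym lj mul0r.
    by rewrite mul1r; ring.
  by apply: (ID); apply: (IM).
have n0 : (0 < n)%N by rewrite -ltnS -nE.
exists n, H; rewrite -/C; pose j0 := Ordinal n0.
have -> : (\det C)%:P = \sum_(j < n) (\adj C j0 j)%:P * \sum_(l < n) (C j l)%:P * 'X^l.
  under eq_bigr => j _ do rewrite mulr_sumr.
  rewrite exchange_big /= (bigD1 j0) //= [X in _ + X]big1 ?addr0.
    under eq_bigr do rewrite mulrA -polyCM.
    rewrite -mulr_suml -raddf_sum.
    have := mul_adj_mx C; move/matrixP/(_ j0 j0); rewrite !mxE eqxx mulr1n => ->.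
    by rewrite mulr1.
  move=> l /negPf lj.
  under eq_bigr do rewrite mulrA -polyCM.
  rewrite -mulr_suml -raddf_sum.
  have := mul_adj_mx C; move/matrixP/(_ j0 l); rewrite !mxE eq_sym lj mulr0n => ->.
  by rewrite mul0r.
have I0 : I 0 by rewrite -(mul0r F); apply: (IM).
by apply: (big_ind I I0 ID) => j _; apply: (IM).
Qed.

(** Nullstellensatz in one variable, by descent on the size: at a root [s] of [p], the gcd with an
    element that does not vanish at [s] is strictly smaller. *)
Lemma poly_ideal_unit (k : closedFieldType) (J : {poly k} -> Prop) :
  (forall p q, J p -> J q -> J (p + q)) -> (forall p q, J p -> J (q * p)) ->
  (forall s, exists2 p, J p & p.[s] != 0) -> J 1.
Proof.
move=> JD JM Jpt.
suff step n p : J p -> p != 0 -> (size p <= n)%N -> J 1.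
  have [p Jp ps] := Jpt 0; apply: (step _ p Jp _ (leqnn _)).
  by apply: contraNneq ps => ->; rewrite horner0.
elim: n p => [|n IHn] p Jp p0 szp; first by rewrite size_poly_leq0 (negPf p0) in szp.
have [sz1|] := eqVneq (size p) 1%N.
  have [c c0 pE] := size_poly1P _ (introT eqP sz1).
  have -> : 1 = c^-1%:P * p by rewrite pE -polyCM mulVf.
  exact: (JM).
move=> /closed_rootP[s ps]; have [r Jr rs] := Jpt s.
have [[x y] /= gE] := Bezoutp p r.
set g := x * p + y * r in gE.
have Jg : J g by apply: (JD); apply: (JM).
have g0 : g != 0.
  by rewrite -size_poly_eq0 (eqp_size gE) size_poly_eq0 gcdp_eq0 (negPf p0).
apply: (IHn g) => //; rewrite -ltnS (leq_trans _ szp) //.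
rewrite (eqp_size gE) ltnNge; apply/negP => szg.
have : gcdp p r %= p.
  rewrite -dvdp_size_eqp ?dvdp_gcdl // eqn_leq szg andbT.
  by rewrite dvdp_leq // dvdp_gcdl.
move=> /eqp_root/(_ s); rewrite ps root_gcd => /andP[_].
by rewrite /root (negPf rs).
Qed.

(** * The Jacobian ideal contains powers of linear forms *)

Section SmoothCubic.
Variables (k : closedFieldType) (f : mpoly 3 k).
Hypothesis three_neq0 : 3%:R != 0 :> k.
Hypothesis f_homog : f \is ishomog1 3 mdeg.
Hypothesis grad_neq0 : forall v : 'I_3 -> k,
  (exists i, v i != 0) -> exists j, meval v (mderiv j f) != 0.

Section AffineChart.
Variables p q r : 'I_3 -> k.
Hypothesis fr : meval r f != 0.
(* The chart [(s, t) |-> p + s q + t r] avoids the origin of affine space. *)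
Hypothesis chart_neq0 : forall s t, exists i, p i + q i * s + r i * t != 0.

Definition chart_sub : {rmorphism mpoly 3 k -> {poly {poly k}}} :=
  mmap (polyC \o polyC)
    (fun i => ((p i)%:P + (q i)%:P * 'X)%:P + ((r i)%:P)%:P * 'X).

Lemma chart_subC c : chart_sub (mpolyC 3 c) = c%:P%:P.
Proof. exact: mmapC. Qed.

Lemma chart_subX i :
  chart_sub (mX i) = ((p i)%:P + (q i)%:P * 'X)%:P + ((r i)%:P)%:P * 'X.
Proof. by rewrite /chart_sub /= mmapX mmap1U. Qed.

Lemma chart_sub_eval s t P :
  (chart_sub P).[t%:P].[s] = meval (fun i => p i + q i * s + r i * t) P.
Proof.
pose phi : {rmorphism mpoly 3 k -> k} :=
  horner_eval s \o horner_eval (t%:P : {poly k}) \o chart_sub.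
rewrite -[LHS]/(phi P); move: P; apply: mpoly_rmorph_ext => [c|i].
  by rewrite /phi /= /horner_eval chart_subC mevalC !hornerC.
by rewrite /phi /= /horner_eval chart_subX mevalXU !hornerE.
Qed.

Lemma chart_sub_top : (size (chart_sub f) <= 4)%N /\ (chart_sub f)`_3 = (meval r f)%:P.
Proof.
have [sz ->] := mmap_linear_top polyC (fun i => (r i)%:P)
  (fun i => (p i)%:P + (q i)%:P * 'X) f_homog; split=> //.
pose phi : {rmorphism mpoly 3 k -> {poly k}} := mmap polyC (fun i => (r i)%:P).
pose psi : {rmorphism mpoly 3 k -> {poly k}} := polyC \o meval r.
apply: (mpoly_rmorph_ext (phi := phi) (psi := psi)) => [c|i].
  by rewrite /phi /psi /= mmapC mevalC.
by rewrite /phi /psi /= mmapX mmap1U mevalXU.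
Qed.

(** Nullstellensatz in two variables, by elimination of [t]. The ideal of the derivatives contains a
    polynomial monic in [t], so it suffices that its elements free of [t] have no common zero; for
    each [s], one of them is built from a Bezout relation on the line over [s]. *)
Lemma chart_jacobian_unit : exists A : 'I_3 -> {poly {poly k}},
  \sum_i A i * chart_sub (mderiv i f) = 1.
Proof.
pose I (P : {poly {poly k}}) :=
  exists A : 'I_3 -> {poly {poly k}}, \sum_i A i * chart_sub (mderiv i f) = P.
have ID P Q : I P -> I Q -> I (P + Q).
  move=> [A <-] [B <-]; exists (fun i => A i + B i); rewrite -big_split.
  by apply: eq_bigr => i _; rewrite mulrDl.
have IM P Q : I P -> I (Q * P).
  move=> [A <-]; exists (fun i => Q * A i); rewrite mulr_sumr.
  by apply: eq_bigr => i _; rewrite mulrA.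
have [szf topf] := chart_sub_top.
(* Euler's formula, with 3 invertible, puts [f] in the ideal of its derivatives. *)
have If : I (chart_sub f).
  have -> : f = mpolyC 3 3%:R^-1 * (f *+ 3).
    rewrite -[f *+ 3]mulr_natl mulrA -(rmorph_nat (@mpolyC 3 k)) -rmorphM /=.
    by rewrite mulVf // mpolyC1 mul1r.
  rewrite -(euler_homog f_homog) rmorphM rmorph_sum; apply: IM.
  by exists (fun i => chart_sub (mX i)); apply: eq_bigr => i _; rewrite rmorphM.
pose F := (meval r f)^-1%:P%:P * chart_sub f.
have IF : I F by apply: (IM).
have F3 : F`_3 = 1 by rewrite /F coefCM topf -polyCM mulVf.
have szF : size F = 4.
  apply/eqP; rewrite eqn_leq; apply/andP; split.
    by rewrite /F mul_polyC (leq_trans (size_scale_leq _ _)).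
  by rewrite ltnNge; apply/negP => /leq_sizeP/(_ 3 (leqnn _))/eqP; rewrite F3 oner_eq0.
have Fmon : F \is monic by rewrite monicE lead_coefE szF F3.
suff [A AE] : I 1 by exists A.
suff : (fun c : {poly k} => I c%:P) 1 by [].
apply: (@poly_ideal_unit k (fun c => I c%:P)) => [c d|c d|s] /=.
- by rewrite polyCD; apply: (ID).
- by rewrite polyCM; apply: (IM).
pose G i := map_poly (horner_eval s) (chart_sub (mderiv i f)).
have Groot t : exists i, ~~ root (G i) t.
  have /grad_neq0[i] := chart_neq0 s t; rewrite -chart_sub_eval => nz.
  exists i; rewrite /root /G.
  have -> : t = horner_eval s (t%:P) by rewrite /horner_eval hornerC.
  by rewrite horner_map.
have [a aE] : exists a : 'I_3 -> {poly k}, \sum_i a i * G i = 1.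
  pose Ia P := exists a : 'I_3 -> {poly k}, \sum_i a i * G i = P.
  have IaD P Q : Ia P -> Ia Q -> Ia (P + Q).
    move=> [x <-] [y <-]; exists (fun i => x i + y i); rewrite -big_split.
    by apply: eq_bigr => i _; rewrite mulrDl.
  have IaM P Q : Ia P -> Ia (Q * P).
    move=> [x <-]; exists (fun i => Q * x i); rewrite mulr_sumr.
    by apply: eq_bigr => i _; rewrite mulrA.
  have IaG i : Ia (G i).
    exists (fun j => (j == i)%:R); rewrite (bigD1 i) //= eqxx mul1r big1 ?addr0 //.
    by move=> j /negPf ->; rewrite mul0r.
  have Iagcd P Q : Ia P -> Ia Q -> Ia (gcdp P Q).
    move=> IP IQ; have [[x y] /= /andP[/dvdpP[c ->] _]] := Bezoutp P Q.
    by apply: (IaM); apply: (IaD); apply: (IaM).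
  set d := gcdp (gcdp (G (inord 0)) (G (inord 1))) (G (inord 2)).
  have Id : Ia d by apply: (Iagcd) => //; apply: (Iagcd).
  have : size d == 1%N.
    apply/negPn/negP => /closed_rootP[t]; rewrite !root_gcd -andbA => /and3P[r0 r1 r2].
    have [i /negP] := Groot t; apply.
    exact: (@ord3_ind (fun i => root (G i) t) r0 r1 r2 i).
  move=> /size_poly1P[c c0 dc]; suff : Ia (c^-1%:P * d) by rewrite dc -polyCM mulVf.
  exact: (IaM).
(* With its coefficients lifted, the Bezout relation holds modulo [X - s], as [elim_monic] requires;
   the determinant obtained takes the value 1 at [s]. *)
pose L i : {poly {poly k}} := map_poly polyC (a i).
pose W := 1 - \sum_i L i * chart_sub (mderiv i f).
have W0 : map_poly (horner_eval s) W = 0.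
  rewrite /W rmorphB rmorph1 rmorph_sum /= -aE -sumrB big1 // => i _.
  rewrite rmorphM /= -/(G i) -map_poly_comp map_poly_id ?subrr // => x _.
  by rewrite /= /horner_eval hornerC.
have [h Wh] : exists h, W = ('X - s%:P)%:P * h.
  exists (map_poly (fun c => c %/ ('X - s%:P)) W); apply/polyP => i.
  rewrite coefCM coef_map_id0 ?div0p // mulrC divpK // dvdp_XsubCl /root.
  by have := congr1 (fun P : {poly k} => P`_i) W0; rewrite coef_map coef0 => /eqP.
have [|n [H Hdet]] := @elim_monic _ I F h ('X - s%:P) ID IM Fmon IF.
  by rewrite -Wh opprB addrC subrK; exists L.
exists (\det (1%:M - ('X - s%:P) *: H)) => //.
rewrite -[X in X != 0]/(horner_eval s _) -det_map_mx.
have -> : map_mx (horner_eval s) (1%:M - ('X - s%:P) *: H) = 1%:M.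
  rewrite map_mxB map_mxZ map_mx1 /= /horner_eval hornerXsubC subrr scale0r.
  by rewrite subr0.
by rewrite det1 oner_eq0.
Qed.

(* Dehomogenising, [1] is a combination of the partial derivatives modulo [l - 1]; the
   homogeneous components of this relation telescope to one for a power of [l]. *)
Lemma jacobian_power (ss st l : mpoly 3 k) :
  l \is ishomog1 1 mdeg ->
  (forall i, exists c, mpolyC 3 (p i) + mpolyC 3 (q i) * ss + mpolyC 3 (r i) * st
                       - mX i = (l - 1) * c) ->
  exists n (A : 'I_3 -> mpoly 3 k), (forall i, A i \is ishomog1 n mdeg) /\
    \sum_i A i * mderiv i f = l ^+ n.+2.
Proof.
move=> homl lX.
pose inner : {rmorphism {poly k} -> mpoly 3 k} :=
  horner_eval ss \o map_poly (@mpolyC 3 k).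
pose tau : {rmorphism {poly {poly k}} -> mpoly 3 k} :=
  horner_eval st \o map_poly inner.
have innerC c : inner c%:P = mpolyC 3 c.
  by rewrite -[LHS]/((map_poly (@mpolyC 3 k) c%:P).[ss]) map_polyC hornerC.
have innerX : inner 'X = ss.
  by rewrite -[LHS]/((map_poly (@mpolyC 3 k) 'X).[ss]) map_polyX hornerX.
have tauP c : tau c%:P = inner c.
  by rewrite -[LHS]/((map_poly inner c%:P).[st]) map_polyC hornerC.
have tau_X : tau 'X = st.
  by rewrite -[LHS]/((map_poly inner 'X).[st]) map_polyX hornerX.
have tauC c : tau c%:P%:P = mpolyC 3 c by rewrite tauP innerC.
have tauX P : exists c, tau (chart_sub P) - P = (l - 1) * c.
  pose phi : {rmorphism mpoly 3 k -> mpoly 3 k} := tau \o chart_sub.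
  have := mpoly_rmorph_cong (phi := phi) (psi := idfun) (l := l - 1); apply=> [c|i].
    by rewrite -[phi _]/(tau (chart_sub (mpolyC 3 c))) chart_subC tauC.
  have [c cE] := lX i; exists c; rewrite -cE -[phi (mX i)]/(tau (chart_sub (mX i))).
  rewrite chart_subX; congr (_ - _).
  by rewrite rmorphD rmorphM tau_X tauC tauP rmorphD rmorphM !innerC innerX.
have [A AE] := chart_jacobian_unit.
pose c i := projT1 (cid (tauX (mderiv i f))).
have cE i : tau (chart_sub (mderiv i f)) = mderiv i f + (l - 1) * c i.
  by rewrite /c; case: cid => x /= <-; rewrite addrC subrK.
pose B i := tau (A i); pose t := \sum_i B i * c i.
have rel : 1 = \sum_i B i * mderiv i f + (l * t - t).
  rewrite -[LHS](rmorph1 tau) -AE rmorph_sum /t -{2}[\sum_i B i * c i]mul1r.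
  rewrite -mulrBl mulr_sumr -big_split; apply: eq_bigr => i _.
  by rewrite rmorphM cE /= mulrDr mulrCA.
have homd i : mderiv i f \is ishomog1 2 mdeg by exact: mderiv_homog.
pose P d (s : mpoly 3 k) : mpoly 3 k := pihomog mdeg d s.
have comp d : P d t =
    \sum_i P d (mderiv i f * B i) + P d (l * t) - P d 1.
  have tE : t = \sum_i mderiv i f * B i + l * t - 1.
    have -> : \sum_i mderiv i f * B i = \sum_i B i * mderiv i f.
      by apply: eq_bigr => i _; rewrite mulrC.
    rewrite [X in _ - X]rel; ring.
  by rewrite /P [in LHS]tE linearB linearD linear_sum.
have P1 d : P d.+1 1 = 0 by apply: (@pihomog_ne0 _ _ _ 0%N); rewrite ?dhomog1.
have Pl d : P d.+1 (l * t) = l * P d t.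
  by rewrite /P -[d.+1]/(1 + d)%N (pihomog_mul _ _ homl).
have Pf d i : P d.+2 (mderiv i f * B i) = mderiv i f * P d (B i).
  by rewrite /P -[d.+2]/(2 + d)%N (pihomog_mul _ _ (homd i)).
have P0t : P 0%N t = - 1.
  rewrite comp big1; last by move=> i _; apply: (pihomog_mul_lt _ (homd i)).
  by rewrite /P (pihomog_mul_lt _ homl) // pihomog_dE ?dhomog1 // !add0r.
have P1t : P 1%N t = - l.
  rewrite comp big1; last by move=> i _; apply: (pihomog_mul_lt _ (homd i)).
  by rewrite Pl P0t P1 subr0 add0r mulrN1.
(* Each component of [t] is [l] times the preceding one plus a Jacobian term. It starts at [- 1] in
   degree 0, so its difference with [- l ^ d] in degree [d] stays in the ideal. *)
have rec n : exists C : 'I_3 -> mpoly 3 k, (forall i, C i \is ishomog1 n mdeg) /\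
    \sum_i C i * mderiv i f = l ^+ n.+2 + P n.+2 t.
  elim: n => [|n [C [homC CE]]].
    exists (fun i => P 0%N (B i)); split=> [i|]; first exact: pihomogP.
    rewrite comp Pl P1t P1 subr0 mulrN expr2 addrCA subrr addr0.
    by apply: eq_bigr => i _; rewrite Pf mulrC.
  exists (fun i => P n.+1 (B i) + l * C i); split=> [i|].
    by rewrite rpredD ?pihomogP //; apply: (dhomogM homl (homC i)).
  under eq_bigr do rewrite mulrDl -mulrA; rewrite big_split /= -mulr_sumr CE.
  rewrite [P n.+3 t]comp Pl P1 subr0 mulrDr -exprS addrCA; congr (_ + (_ + _)).
  by apply: eq_bigr => i _; rewrite Pf mulrC.
(* Above its degree [t] has no component, and only the power of [l] remains. *)
pose n := mmeasure mdeg t; exists n.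
have [C [homC CE]] := rec n; exists C; split=> //.
rewrite CE /P (pihomog_partitionE (leqnn (mmeasure mdeg t))) linear_sum /=.
rewrite big1 ?addr0 //.
move=> i _; apply: (@pihomog_ne0 _ _ _ i); last exact: pihomogP.
by rewrite ltn_eqF // (leq_trans (ltn_ord i)) // /n ltnW.
Qed.

End AffineChart.
End SmoothCubic.

(** * The coordinate ring *)

Section CoordinateRing.
Variables (k : fieldType) (f : mpoly 3 k).

Lemma to_coord_is_monoid_morphism : monoid_morphism (@to_coord k f).
Proof. by split=> [//|p q]; rewrite -coord_mul_pi. Qed.
HB.instance Definition _ :=
  GRing.isZmodMorphism.Build (mpoly 3 k) (coord_ring f) (@to_coord k f) (raddfB _).
HB.instance Definition _ :=
  GRing.isMonoidMorphism.Build (mpoly 3 k) (coord_ring f) (@to_coord k f)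
    to_coord_is_monoid_morphism.

Lemma to_coord_eq0 p : to_coord f p = 0 <-> exists q, p = q * f.
Proof.
have idE : (p \in ideal_pred f) = (to_coord f p == 0).
  rewrite -[in RHS](raddf0 (@to_coord k f)) -[in LHS](subr0 p).
  exact: Quotient.idealrBE.
split=> [p0|[q pq]].
  by have : p \in ideal_pred f by [rewrite idE p0 eqxx]; move/asboolP.
have : to_coord f p == 0 by rewrite -idE; apply/asboolP; exists q.
by move/eqP.
Qed.

Lemma to_coord_eq p q : to_coord f p = to_coord f q <-> exists r, p - q = r * f.
Proof.
split=> [pq|/to_coord_eq0].
  by apply/to_coord_eq0; rewrite rmorphB /= pq subrr.
by rewrite rmorphB /= => /eqP; rewrite subr_eq0 => /eqP.
Qed.

Lemma to_coord_surj (x : coord_ring f) : exists p, x = to_coord f p.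
Proof. by exists (repr x); rewrite to_coord_repr. Qed.

Lemma coord_deg0 i : coord_deg i (0 : coord_ring f).
Proof.
case: i => n //=; exists 0; last exact: rmorph0.
exact: dhomog0.
Qed.

Lemma coord_degB i (x y : coord_ring f) :
  coord_deg i x -> coord_deg i y -> coord_deg i (x - y).
Proof.
case: i => n /=; last by move=> -> ->; rewrite subrr.
move=> [p hp <-] [q hq <-]; exists (p - q); last exact: rmorphB.
exact: rpredB.
Qed.

Lemma coord_deg1 : coord_deg 0 (1 : coord_ring f).
Proof. by exists 1; [exact: dhomog1 | exact: rmorph1]. Qed.

Lemma coord_degM i j (x y : coord_ring f) :
  coord_deg i x -> coord_deg j y -> coord_deg (i + j) (x * y).
Proof.
case: i => m; last by move=> ->; rewrite mul0r => _; apply: coord_deg0.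
case: j => n; last by move=> _ ->; rewrite mulr0; apply: coord_deg0.
move=> [p hp <-] [q hq <-]; exists (p * q); last exact: rmorphM.
exact: dhomogM.
Qed.

Lemma coord_deg_neg i (x : coord_ring f) : i < 0 -> coord_deg i x -> x = 0.
Proof. by case: i. Qed.

Lemma coord_deg_to_coord n p : p \is ishomog1 n mdeg -> coord_deg n%:Z (to_coord f p).
Proof. by exists p. Qed.

Hypothesis f_homog : f \is ishomog1 3 mdeg.

Lemma pihomog_ideal n q : exists q', pihomog mdeg n (q * f) = q' * f.
Proof.
case: (leqP 3 n) => [/subnKC <-|n3].
  by exists (pihomog mdeg (n - 3) q); rewrite mulrC (pihomog_mul _ _ f_homog) mulrC.
by exists 0; rewrite mulrC (pihomog_mul_lt _ f_homog) // mul0r.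
Qed.

(** The ideal of [f] being homogeneous, a lift of [x] can be replaced by its component of degree
    [i]: the difference is killed by [w], which is regular. *)
Lemma coord_deg_div e (w : mpoly 3 k) i x :
  w \is ishomog1 e mdeg -> (forall y, to_coord f w * y = 0 -> y = 0) ->
  coord_deg (i + e%:Z) (to_coord f w * x) -> coord_deg i x.
Proof.
move=> homw w_reg; have [p ->] := to_coord_surj x.
case E : (i + e%:Z) => [n|n]; last first.
  by move=> /= /w_reg ->; apply: coord_deg0.
rewrite -rmorphM => -[h homh /to_coord_eq[c hE]].
have [c' c'E] := pihomog_ideal n c.
(* For negative [i] the claim is [x = 0]: a multiple of [w] has no component of degree below [e]. *)
case: i E => m E; last first.
  have ne : (n < e)%N by move: E; lia.
  have h0 : h = c' * f.
    have := congr1 (pihomog mdeg n) hE.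
    by rewrite c'E linearB /= (pihomog_mul_lt _ homw) // subr0 pihomog_dE.
  rewrite /=; apply: w_reg; rewrite -rmorphM; apply/to_coord_eq0.
  by exists (c' - c); rewrite mulrBl -h0 -hE opprB addrC subrK.
have nE : n = (e + m)%N by move: E; lia.
have hp : h - w * pihomog mdeg m p = c' * f.
  have := congr1 (pihomog mdeg n) hE.
  by rewrite c'E linearB /= {2}nE (pihomog_mul _ _ homw) pihomog_dE.
exists (pihomog mdeg m p); first exact: pihomogP.
apply/eqP; rewrite -subr_eq0; apply/eqP/w_reg; rewrite -rmorphB -rmorphM.
apply/to_coord_eq0; exists (c - c').
by rewrite mulrBr mulrBl -hE -hp; ring.
Qed.

End CoordinateRing.

Lemma homog0_const (n : nat) (k : comNzRingType) (p : mpoly n k) :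
  p \is ishomog1 0 mdeg -> p = mpolyC n (mcoeff mnm0 p).
Proof.
move=> hp; apply/mpolyP => m; rewrite mcoeffC.
have [->|m0] := eqVneq mnm0 m; first by rewrite mulr1.
rewrite mulr0; apply: (dhomog_nemf_coeff hp).
by rewrite /= mdeg_eq0 eq_sym.
Qed.

Lemma mderiv_var (n : nat) (k : comNzRingType) (i j : 'I_n) :
  mderiv i (mX j : mpoly n k) = (i == j)%:R.
Proof.
rewrite mderivX mnm1E eq_sym; have [->|_] := eqVneq i j; last by rewrite scale0r.
have -> : mnm_sub (mnm1 j) (mnm1 j) = mnm0.
  by apply/mnmP => l; rewrite mnmBE subnn mnm0E.
by rewrite scale1r mpolyX0.
Qed.

Lemma inord3_eq i j : (i < 3)%N -> (j < 3)%N ->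
  (inord i == inord j :> 'I_3) = (i == j).
Proof. by move=> i3 j3; rewrite -val_eqE /= !inordK. Qed.

(** * Two lines through a point off the curve *)

Section Shear.
Variables (k : closedFieldType) (f : mpoly 3 k) (a b : k).
Hypothesis three_neq0 : 3%:R != 0 :> k.
Hypothesis f_homog : f \is ishomog1 3 mdeg.

(** The default value 1 of [nth] is the third coordinate. *)
Definition pt (i : 'I_3) : k := nth 1 [:: a; b] i.
Hypothesis fpt : meval pt f != 0.

(* [ul] and [vl] are the lines through the point [pt], and [gl] is its polar conic. *)
Definition ul : mpoly 3 k := mX (inord 0) - mpolyC 3 a * mX (inord 2).
Definition vl : mpoly 3 k := mX (inord 1) - mpolyC 3 b * mX (inord 2).
Definition gl : mpoly 3 k := \sum_i mpolyC 3 (pt i) * mderiv i f.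

(** Restriction to a line, kept as an endomorphism of the polynomial ring, so that a product of
    nonzero restrictions is nonzero. *)
Definition kill (c : k) (i0 : 'I_3) : {rmorphism mpoly 3 k -> mpoly 3 k} :=
  mmap (@mpolyC 3 k) (fun i => if i == i0 then mpolyC 3 c * mX (inord 2) else mX i).

Lemma killX c i0 i :
  kill c i0 (mX i) = if i == i0 then mpolyC 3 c * mX (inord 2) else mX i.
Proof. by rewrite /kill /= mmapX mmap1U. Qed.

Lemma killC c i0 d : kill c i0 (mpolyC 3 d) = mpolyC 3 d.
Proof. exact: mmapC. Qed.

Lemma kill_mod c i0 p :
  exists q, p - kill c i0 p = (mX i0 - mpolyC 3 c * mX (inord 2)) * q.
Proof.
apply: (mpoly_rmorph_cong (phi := idfun)) => [d|i] /=; first by rewrite killC.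
rewrite killX; case: eqP => [->|_]; first by exists 1; rewrite mulr1.
by exists 0; rewrite subrr mulr0.
Qed.

Lemma kill_eval c i0 p : pt i0 = c -> meval pt (kill c i0 p) = meval pt p.
Proof.
move=> ptc; pose phi : {rmorphism mpoly 3 k -> k} := meval pt \o kill c i0.
rewrite -[LHS]/(phi p); move: p; apply: mpoly_rmorph_ext => [d|i].
  by rewrite /phi /= killC !mevalC.
rewrite /phi /= killX; case: eqP => [->|//].
by rewrite rmorphM /= mevalC !mevalXU ptc /pt inordK // mulr1.
Qed.

Lemma pt0 : pt (inord 0) = a. Proof. by rewrite /pt inordK. Qed.
Lemma pt1 : pt (inord 1) = b. Proof. by rewrite /pt inordK. Qed.
Lemma pt2 : pt (inord 2) = 1. Proof. by rewrite /pt inordK. Qed.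

Lemma kill_ul : kill a (inord 0) ul = 0.
Proof.
rewrite /ul rmorphB rmorphM /= killC !killX !inord3_eq //=.
by rewrite subrr.
Qed.

Lemma kill_vl : kill b (inord 1) vl = 0.
Proof.
rewrite /vl rmorphB rmorphM /= killC !killX !inord3_eq //=.
by rewrite subrr.
Qed.

Lemma kill_vl_u : kill a (inord 0) vl = vl.
Proof.
by rewrite /vl rmorphB rmorphM /= killC !killX !inord3_eq.
Qed.

Lemma ul_neq0 : ul != 0.
Proof.
have : mderiv (inord 0) ul != 0.
  rewrite /ul linearB mul_mpolyC linearZ /= !mderiv_var !inord3_eq //=.
  by rewrite scaler0 subr0 oner_eq0.
by apply: contraNneq => ->; rewrite linear0.
Qed.

Lemma vl_neq0 : vl != 0.
Proof.
have : mderiv (inord 1) vl != 0.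
  rewrite /vl linearB mul_mpolyC linearZ /= !mderiv_var !inord3_eq //=.
  by rewrite scaler0 subr0 oner_eq0.
by apply: contraNneq => ->; rewrite linear0.
Qed.

(** The point [pt] lies on the line, so the restriction takes at [pt] the same value as [f]. *)
Lemma kill_f_neq0 : kill a (inord 0) f != 0.
Proof.
by apply: contraNneq fpt => kf; rewrite -(kill_eval f pt0) kf rmorph0.
Qed.

Lemma kill2_f_neq0 : kill b (inord 1) (kill a (inord 0) f) != 0.
Proof.
apply: contraNneq fpt => kf.
by rewrite -(kill_eval f pt0) -(kill_eval _ pt1) kf rmorph0.
Qed.

(** Restricting [ul p = h f] to the line shows that [h] vanishes there; it is then divisible by
    [ul], which is cancelled. *)
Lemma ul_reg x : to_coord f ul * x = 0 -> x = 0.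
Proof.
have [p ->] := to_coord_surj x; rewrite -rmorphM => /to_coord_eq0[h uph].
have /eqP : kill a (inord 0) h * kill a (inord 0) f = 0.
  by rewrite -rmorphM -uph rmorphM kill_ul mul0r.
rewrite mulf_eq0 (negPf kill_f_neq0) orbF => /eqP kh.
have [h' hE] := kill_mod a (inord 0) h.
apply/to_coord_eq0; exists h'; apply: (mulfI ul_neq0).
by rewrite uph mulrA -[ul * h']hE kh subr0.
Qed.

(** Let [vl p - ul c = d f]. On [ul = 0] this reads [vl p = d f]; restricting also to [vl = 0] shows
    that there [vl] divides [d], so [p] is a multiple of [f] on [ul = 0]. *)
Lemma vl_ul_reg x y : to_coord f vl * x = to_coord f ul * y ->
  exists c, x = to_coord f ul * c.
Proof.
have [p ->] := to_coord_surj x; have [c ->] := to_coord_surj y.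
rewrite -!rmorphM => /to_coord_eq[d E].
have [p1 p1E] := kill_mod a (inord 0) p.
have [f1 f1E] := kill_mod a (inord 0) f.
have := kill_vl; have := kill_ul; have := kill_vl_u; have := kill2_f_neq0.
have := kill_mod b (inord 1) (kill a (inord 0) d).
move: p1E f1E; move: (kill a (inord 0)) (kill b (inord 1)) => ku kv.
move=> p1E f1E [d' dE] kf ku_v ku_u kv_v.
have Eu : vl * ku p = ku d * ku f.
  by rewrite -[RHS]rmorphM -E rmorphB !rmorphM /= ku_u ku_v mul0r subr0.
have /eqP : kv (ku d) * kv (ku f) = 0.
  by rewrite -rmorphM -Eu rmorphM /= kv_v mul0r.
rewrite mulf_eq0 (negPf kf) orbF => /eqP kd.
have pE : ku p = d' * ku f.
  apply: (mulfI vl_neq0); rewrite Eu mulrA; congr (_ * _).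
  by rewrite -[RHS]dE kd subr0.
exists (to_coord f (p1 - d' * f1)); rewrite -rmorphM; apply/to_coord_eq.
exists d'; rewrite mulrBr -p1E mulrCA -f1E pE; ring.
Qed.

(* Restriction to the cone over [pt] kills [ul] and [vl], and sends [gl], [f] to nonzero
   multiples of ['X^2], ['X^3]. *)
Lemma gl_const c x y : coord_deg 0 c ->
  to_coord f gl * c = to_coord f vl * x - to_coord f ul * y -> c = 0.
Proof.
have [X ->] := to_coord_surj x; have [Y ->] := to_coord_surj y.
move=> [C /homog0_const -> <-]; set c0 := mcoeff _ _.
rewrite -!rmorphM -rmorphB => /to_coord_eq[W E].
pose ev : {rmorphism mpoly 3 k -> {poly k}} :=
  mmap polyC (fun i => 'X * (pt i)%:P).
have evC d : ev (mpolyC 3 d) = d%:P by exact: mmapC.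
have evX i : ev (mX i) = 'X * (pt i)%:P by rewrite /ev /= mmapX mmap1U.
have ev_homog d p : p \is ishomog1 d mdeg -> ev p = 'X^d * (meval pt p)%:P.
  move=> homp; rewrite /ev /= (mmap_homog_scale _ _ _ homp); congr (_ * _).
  pose phi : {rmorphism mpoly 3 k -> {poly k}} := mmap polyC (fun i => (pt i)%:P).
  pose psi : {rmorphism mpoly 3 k -> {poly k}} := polyC \o meval pt.
  apply: (mpoly_rmorph_ext (phi := phi) (psi := psi)) => [d'|i].
    by rewrite /phi /psi /= mmapC mevalC.
  by rewrite /phi /psi /= mmapX mmap1U mevalXU.
have evu : ev ul = 0.
  by rewrite /ul rmorphB rmorphM /= evC !evX pt0 pt2 mulr1 mulrC subrr.
have evv : ev vl = 0.
  by rewrite /vl rmorphB rmorphM /= evC !evX pt1 pt2 mulr1 mulrC subrr.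
have evg : ev gl = 'X^2 * (3%:R * meval pt f)%:P.
  have -> : 3%:R * meval pt f = \sum_i pt i * meval pt (mderiv i f).
    rewrite mulr_natl -rmorphMn -(euler_homog f_homog) rmorph_sum.
    by apply: eq_bigr => i _; rewrite rmorphM /= mevalXU.
  rewrite /gl rmorph_sum rmorph_sum mulr_sumr; apply: eq_bigr => i _.
  rewrite rmorphM /= evC (ev_homog 2) ?mderiv_homog // polyCM; ring.
have evE : ev gl * ev (mpolyC 3 c0) - (ev vl * ev X - ev ul * ev Y) = ev W * ev f.
  by rewrite -!rmorphM -!rmorphB E.
rewrite evu evv evg evC (ev_homog 3 f) // !mul0r !subr0 in evE.
have := congr1 (fun P : {poly k} => P`_2) evE; rewrite /=.
rewrite -mulrA -polyCM coefXnM /= coefC /=.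
have -> : ev W * ('X^3 * (meval pt f)%:P) = 'X^3 * (ev W * (meval pt f)%:P) by ring.
rewrite coefXnM /= => /eqP; rewrite !mulf_eq0 (negPf three_neq0) (negPf fpt) /=.
by move=> /eqP ->; rewrite mpolyC0 rmorph0.
Qed.

Lemma var_homog i : (mX i : mpoly 3 k) \is ishomog1 1 mdeg.
Proof. by rewrite dhomogX; apply/eqP/mdeg1. Qed.

Lemma ul_homog : ul \is ishomog1 1 mdeg.
Proof. by rewrite rpredB ?mul_mpolyC ?rpredZ ?var_homog. Qed.

Lemma vl_homog : vl \is ishomog1 1 mdeg.
Proof. by rewrite rpredB ?mul_mpolyC ?rpredZ ?var_homog. Qed.

End Shear.

(** * Derivations and the invariant differential *)

Section Kahler.
Variables (A : comPzRingType) (gA : int -> set A) (k : Type) (iota : k -> A).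

Definition kahler_d (x : A) : kahler gA iota := quot_gen _ x.

Lemma kahler_dD x y : kahler_d (x + y) = kahler_d x + kahler_d y.
Proof.
apply/eqP; rewrite -subr_eq0 opprD addrA; apply/eqP.
rewrite /kahler_d -[LHS]/(quot_pi _ _ - quot_pi _ _ - quot_pi _ _) -!linearB.
by apply: quot_pi_rel; apply: Or31; exists x, y.
Qed.

Lemma kahler_dM x y : kahler_d (x * y) = x *: kahler_d y + y *: kahler_d x.
Proof.
apply/eqP; rewrite -subr_eq0 opprD addrA; apply/eqP.
rewrite /kahler_d -[LHS]/(quot_pi _ _ - x *: quot_pi _ _ - y *: quot_pi _ _).
rewrite -![_ *: quot_pi _ _]linearZ -!linearB.
by apply: quot_pi_rel; apply: Or32; exists x, y.
Qed.

Lemma kahler_d_iota c : kahler_d (iota c) = 0.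
Proof. by apply: quot_pi_rel; apply: Or33; exists c. Qed.

Lemma kahler_ext (V : lmodType A) (phi psi : {linear kahler gA iota -> V}) :
  (forall x, phi (kahler_d x) = psi (kahler_d x)) -> phi =1 psi.
Proof. exact: quot_mod_ext. Qed.

Lemma kahler_lift (V : lmodType A) (h : A -> V) :
  {morph h : x y / x + y} -> (forall x y, h (x * y) = x *: h y + y *: h x) ->
  (forall c, h (iota c) = 0) ->
  exists phi : {linear kahler gA iota -> V}, forall x, phi (kahler_d x) = h x.
Proof.
move=> hD hM hiota; apply: quot_mod_lift => w [[x [y ->]]|[x [y ->]]|[c ->]].
- by rewrite !linearB /= !free_lift_gen hD addrAC addrK subrr.
- have LZ c z : free_lift h (c *: free_gen A z) = c *: h z.
    by rewrite linearZ /= free_lift_gen.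
  by rewrite !linearB /= !LZ free_lift_gen hM addrAC addrK subrr.
- by rewrite free_lift_gen hiota.
Qed.

End Kahler.

Section KahlerCubic.
Variables (k : closedFieldType) (f : mpoly 3 k).
Local Notation R := (coord_ring f).
Local Notation Om := (coord_kahler f).
Local Notation tc := (to_coord f).
Local Notation d := (@kahler_d R (@coord_deg k f) k (fun c => tc (mpolyC 3 c))).

Lemma der_add (D : dual Om) x y : D (d (x + y)) = D (d x) + D (d y).
Proof. by rewrite kahler_dD; apply: linearD. Qed.

Lemma der_mul (D : dual Om) x y : D (d (x * y)) = x * D (d y) + y * D (d x).
Proof. by rewrite kahler_dM -!dual_appZ; apply: linearD. Qed.

Lemma der_const (D : dual Om) c : D (d (tc (mpolyC 3 c))) = 0.
Proof. by rewrite (kahler_d_iota _ (fun c => tc (mpolyC 3 c))); apply: linear0. Qed.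

Lemma der_chain (D : dual Om) p :
  D (d (tc p)) = \sum_(i < 3) D (d (tc (mX i))) * tc (mderiv i p).
Proof.
move: p; apply: mpoly_ring_ind => [c|i|p q IHp IHq|p q IHp IHq].
- by rewrite der_const big1 // => i _; rewrite mderivC rmorph0 mulr0.
- rewrite (bigD1 i) //= mderiv_var eqxx rmorph1 mulr1 big1 ?addr0 // => j ji.
  by rewrite mderiv_var (negPf ji) rmorph0 mulr0.
- rewrite rmorphD der_add IHp IHq -big_split; apply: eq_bigr => i _.
  by rewrite linearD rmorphD mulrDr.
rewrite rmorphM der_mul IHp IHq !mulr_sumr -big_split; apply: eq_bigr => i _ /=.
rewrite mderivM rmorphD !rmorphM /=; ring.
Qed.

Lemma der_ext (D D' : dual Om) :
  (forall i, D (d (tc (mX i))) = D' (d (tc (mX i)))) -> D = D'.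
Proof.
move=> DD'; apply: dual_ext => m; move: m; apply: kahler_ext => x.
have [p ->] := to_coord_surj x.
rewrite -[LHS]/(D (d _)) -[RHS]/(D' (d _)) !der_chain.
by apply: eq_bigr => i _; rewrite DD'.
Qed.

Lemma der_gradient (D : dual Om) :
  \sum_(i < 3) D (d (tc (mX i))) * tc (mderiv i f) = 0.
Proof.
rewrite -der_chain; have -> : tc f = tc (mpolyC 3 0).
  by apply/to_coord_eq; exists 1; rewrite mpolyC0 subr0 mul1r.
exact: der_const.
Qed.

(** The vector field with coefficients [c] is tangent to the cone over the curve, so its action does
    not depend on the representative. *)
Lemma der_exists (c : 'I_3 -> R) : \sum_i c i * tc (mderiv i f) = 0 ->
  exists D : dual Om, forall p, D (d (tc p)) = \sum_i c i * tc (mderiv i p).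
Proof.
move=> cf; pose h (x : R) : R := \sum_i c i * tc (mderiv i (repr x)).
have hE p : h (tc p) = \sum_i c i * tc (mderiv i p).
  have /to_coord_eq[r rE] : tc (repr (tc p)) = tc p by exact: to_coord_repr.
  apply/eqP; rewrite -subr_eq0 /h -sumrB; apply/eqP.
  transitivity (tc r * \sum_i c i * tc (mderiv i f)); last by rewrite cf mulr0.
  rewrite mulr_sumr; apply: eq_bigr => i _.
  rewrite -mulrBr -rmorphB -mderivB rE mderivM rmorphD !rmorphM /=.
  have -> : tc f = 0 by apply/to_coord_eq0; exists 1; rewrite mul1r.
  by rewrite mulr0 add0r mulrCA.
have hD (x y : R) : h (x + y) = h x + h y.
  have [p ->] := to_coord_surj x; have [q ->] := to_coord_surj y.
  rewrite -rmorphD !hE -big_split; apply: eq_bigr => i _ /=.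
  by rewrite linearD rmorphD mulrDr.
have hM (x y : R) : h (x * y) = x * h y + y * h x.
  have [p ->] := to_coord_surj x; have [q ->] := to_coord_surj y.
  rewrite -rmorphM !hE !mulr_sumr -big_split; apply: eq_bigr => i _ /=.
  rewrite mderivM rmorphD !rmorphM /=; ring.
have hc c0 : h (tc (mpolyC 3 c0)) = 0.
  by rewrite hE big1 // => i _; rewrite mderivC rmorph0 mulr0.
have [phi phiE] := kahler_lift (@coord_deg k f) (V := R^o) hD hM hc.
have [D DE] := linear_dual phi.
by exists D => p; rewrite DE phiE hE.
Qed.

End KahlerCubic.

Lemma big_ord3 (V : nmodType) (F : 'I_3 -> V) :
  \sum_i F i = F (inord 0) + F (inord 1) + F (inord 2).
Proof.
rewrite !big_ord_recl big_ord0 addr0 addrA.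
by congr (F _ + F _ + F _); apply/val_inj; rewrite /= inordK.
Qed.

(** * The invariant differential and the two charts of the differentials *)

Section InvariantDifferential.
Variables (k : closedFieldType) (f : mpoly 3 k) (a b : k).
Hypothesis f_homog : f \is ishomog1 3 mdeg.
Local Notation R := (coord_ring f).
Local Notation Om := (coord_kahler f).
Local Notation tc := (to_coord f).
Local Notation kahler_d := (@kahler_d R (@coord_deg k f) k (fun c => tc (mpolyC 3 c))).
Local Notation ul := (ul a).
Local Notation vl := (vl b).
Local Notation gl := (gl f a b).
Hypothesis u_reg : forall x, tc ul * x = 0 -> x = 0.
Hypothesis vu_reg : forall x y, tc vl * x = tc ul * y -> exists c, x = tc ul * c.
Hypothesis ul_jac : exists n (A : 'I_3 -> mpoly 3 k),
  (forall i, A i \is ishomog1 n mdeg) /\ \sum_i A i * mderiv i f = ul ^+ n.+2.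
Hypothesis vl_jac : exists n (A : 'I_3 -> mpoly 3 k),
  (forall i, A i \is ishomog1 n mdeg) /\ \sum_i A i * mderiv i f = vl ^+ n.+2.

Definition xx (n : nat) : R := tc (mX (inord n)).
Definition ff (n : nat) : R := tc (mderiv (inord n) f).
Definition dx (D : dual Om) (n : nat) : R := D (kahler_d (xx n)).

Lemma coord_euler : xx 0 * ff 0 + xx 1 * ff 1 + xx 2 * ff 2 = 0.
Proof.
rewrite /xx /ff -!rmorphM -!rmorphD -(big_ord3 (fun i => mX i * mderiv i f)).
rewrite (euler_homog f_homog); apply/to_coord_eq0; exists 3%:R.
by rewrite mulr_natl.
Qed.

Lemma dx_partial D : dx D 0 * ff 0 + dx D 1 * ff 1 + dx D 2 * ff 2 = 0.
Proof. by rewrite -(der_gradient D) big_ord3. Qed.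

Lemma der_dx (c0 c1 c2 : R) : c0 * ff 0 + c1 * ff 1 + c2 * ff 2 = 0 ->
  exists D : dual Om, [/\ dx D 0 = c0, dx D 1 = c1 & dx D 2 = c2].
Proof.
pose c (i : 'I_3) := nth 0 [:: c0; c1; c2] i.
have cE : \sum_i c i * tc (mderiv i f) = c0 * ff 0 + c1 * ff 1 + c2 * ff 2.
  by rewrite big_ord3 /c !inordK.
rewrite -cE => /der_exists[D DE]; exists D.
by split; rewrite /dx /xx DE big_ord3 !mderiv_var !inord3_eq //= rmorph1 !rmorph0
  !mulr0 mulr1 ?addr0 ?add0r /c inordK.
Qed.

Lemma dx_ext D D' : dx D 0 = dx D' 0 -> dx D 1 = dx D' 1 -> dx D 2 = dx D' 2 -> D = D'.
Proof. by move=> E0 E1 E2; apply: der_ext; apply: ord3_ind. Qed.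

Definition cross (D : dual Om) (n : nat) : R :=
  match n with
  | 0 => dx D 1 * xx 2 - dx D 2 * xx 1
  | 1 => dx D 2 * xx 0 - dx D 0 * xx 2
  | _ => dx D 0 * xx 1 - dx D 1 * xx 0
  end.

(* Both the vector [dx D] and the vector of coordinates are orthogonal to the gradient of
   [f], so that their cross product is a multiple of it: the factor is the value on [D]
   of the invariant differential. *)
Definition is_omega (D : dual Om) (c : R) :=
  [/\ cross D 0 = c * ff 0, cross D 1 = c * ff 1 & cross D 2 = c * ff 2].

(** Each difference is a coordinate times [dx_partial] minus a value of [dx D] times
    [coord_euler]. *)
Lemma cross_parallel D i j : (i < 3)%N -> (j < 3)%N ->
  cross D i * ff j = cross D j * ff i.
Proof.
have e := coord_euler; have d := dx_partial D.
have H01 : cross D 0 * ff 1 = cross D 1 * ff 0.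
  apply/eqP; rewrite -subr_eq0 /cross; apply/eqP.
  transitivity (xx 2 * (dx D 0 * ff 0 + dx D 1 * ff 1 + dx D 2 * ff 2)
    - dx D 2 * (xx 0 * ff 0 + xx 1 * ff 1 + xx 2 * ff 2)); first by ring.
  by rewrite e d !mulr0 subrr.
have H12 : cross D 1 * ff 2 = cross D 2 * ff 1.
  apply/eqP; rewrite -subr_eq0 /cross; apply/eqP.
  transitivity (xx 0 * (dx D 0 * ff 0 + dx D 1 * ff 1 + dx D 2 * ff 2)
    - dx D 0 * (xx 0 * ff 0 + xx 1 * ff 1 + xx 2 * ff 2)); first by ring.
  by rewrite e d !mulr0 subrr.
have H20 : cross D 2 * ff 0 = cross D 0 * ff 2.
  apply/eqP; rewrite -subr_eq0 /cross; apply/eqP.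
  transitivity (xx 1 * (dx D 0 * ff 0 + dx D 1 * ff 1 + dx D 2 * ff 2)
    - dx D 1 * (xx 0 * ff 0 + xx 1 * ff 1 + xx 2 * ff 2)); first by ring.
  by rewrite e d !mulr0 subrr.
move: (cross D) ff H01 H12 H20 => C F H01 H12 H20.
by case: i j => [|[|[|]]] // [|[|[|]]].
Qed.

Lemma jac_cross (w : mpoly 3 k) (A : 'I_3 -> mpoly 3 k) D i : (i < 3)%N ->
  \sum_i A i * mderiv i f = w ->
  tc w * cross D i = (\sum_(j < 3) tc (A j) * cross D j) * ff i.
Proof.
move=> i3 <-; rewrite rmorph_sum !mulr_suml; apply: eq_bigr => j _.
rewrite rmorphM -!mulrA; congr (_ * _); rewrite [RHS]cross_parallel //.
by rewrite mulrC /ff inord_val.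
Qed.

(** The factor is [wu / u ^ (m + 2)] on one chart and [wv / v ^ (n + 2)] on the other;
    [regular_pow_dvd] glues the two fractions into an element of the ring. *)
Lemma omega_exists D : exists c, is_omega D c.
Proof.
have [m [A [_ AE]]] := ul_jac; have [n [B [_ BE]]] := vl_jac.
have CA i i3 := @jac_cross _ A D i i3 AE.
have CB i i3 := @jac_cross _ B D i i3 BE.
move: CA CB; set wu := \sum_(j < 3) tc (A j) * _; set wv := \sum_(j < 3) tc (B j) * _.
have -> : tc (ul ^+ m.+2) = tc ul ^+ m.+2 by rewrite rmorphXn.
have -> : tc (vl ^+ n.+2) = tc vl ^+ n.+2 by rewrite rmorphXn.
set U := tc ul; set V := tc vl => CA CB.
(* A power of [u] is a combination of the [ff i], so equality can be tested after multiplication by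
   each of these. *)
have ff_eq x y : (forall i, (i < 3)%N -> x * ff i = y * ff i) -> x = y.
  move=> xy; apply: (reg_pow_inj (n := m.+2) u_reg).
  rewrite -rmorphXn -AE rmorph_sum !mulr_suml; apply: eq_bigr => i _.
  rewrite rmorphM -!mulrA; congr (_ * _); have := xy i (ltn_ord i).
  by rewrite /ff inord_val mulrC [RHS]mulrC.
have E : V ^+ n.+2 * wu = U ^+ m.+2 * wv.
  apply: ff_eq => i i3; rewrite -(mulrA (V ^+ _)) -(mulrA (U ^+ _)) -CA // -CB //.
  exact: mulrCA.
have [c cE] := regular_pow_dvd u_reg vu_reg E.
by exists c; split; apply: (reg_pow_inj (n := m.+2) u_reg);
  rewrite -/U CA // cE (mulrA (U ^+ _)).
Qed.

Lemma omega_unique D c c' : is_omega D c -> is_omega D c' -> c = c'.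
Proof.
move=> [c0 c1 c2] [c0' c1' c2']; have [m [A [_ AE]]] := ul_jac.
apply: (reg_pow_inj (n := m.+2) u_reg).
rewrite -rmorphXn -AE big_ord3 !rmorphD !rmorphM /= -/(ff 0) -/(ff 1) -/(ff 2) !mulrDl.
by rewrite -!(mulrA _ (ff _)) !(mulrC (ff _)) -c0 -c1 -c2 c0' c1' c2'.
Qed.

Definition omega_fun (D : dual Om) : R := projT1 (cid (omega_exists D)).

Lemma omegaP D : is_omega D (omega_fun D).
Proof. by rewrite /omega_fun; case: cid. Qed.

Lemma dx_linear (c : R) D D' n : dx (c *: D + D') n = c * dx D n + dx D' n.
Proof. by []. Qed.

Lemma omega_exists_dual : exists w : dual (dual Om), forall D, is_omega D (w D).
Proof.
have lin : linear (omega_fun : dual Om -> R^o).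
  move=> c D D'; apply: (@omega_unique (c *: D + D')); first exact: omegaP.
  have [D0 D1 D2] := omegaP D; have [D0' D1' D2'] := omegaP D'.
  rewrite -[c *: (_ : R^o) + _]/(c * omega_fun D + omega_fun D').
  split; rewrite [RHS]mulrDl -(mulrA c).
  - rewrite -D0 -D0' /cross !dx_linear; ring.
  - rewrite -D1 -D1' /cross !dx_linear; ring.
  - rewrite -D2 -D2' /cross !dx_linear; ring.
pose phi : {linear dual Om -> R^o} :=
  HB.pack (omega_fun : dual Om -> R^o) (GRing.isLinear.Build _ _ _ _ _ lin).
have [w wE] := linear_dual phi; exists w => D; rewrite wE; exact: omegaP.
Qed.

Lemma coord_degD i (x y : R) : coord_deg i x -> coord_deg i y -> coord_deg i (x + y).
Proof.
move=> xi yi; rewrite -[y]opprK; apply: coord_degB => //.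
by rewrite -sub0r; apply: coord_degB => //; apply: coord_deg0.
Qed.

Lemma coord_deg_sum i n (F : 'I_n -> R) :
  (forall j, coord_deg i (F j)) -> coord_deg i (\sum_j F j).
Proof.
move=> Fi; apply: (big_ind (fun x : R => coord_deg i x)) => //.
- exact: coord_deg0.
- exact: coord_degD.
Qed.

Lemma kahler_d_deg n (p : mpoly 3 k) :
  p \is ishomog1 n mdeg -> @gdeg R Om n%:Z (kahler_d (tc p)).
Proof.
move=> homp; rewrite /coord_kahler /kahler /presented /= => W [_]; apply.
exists 0, n%:Z, 1, (tc p); split; rewrite ?add0r ?scale1r //.
  exact: coord_deg1.
exact: coord_deg_to_coord.
Qed.

Lemma dx_deg i D n : (n < 3)%N -> @gdeg R (gdual (@coord_deg k f) Om) i D ->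
  coord_deg (i + 1) (dx D n).
Proof. by move=> n3 Di; apply: (Di 1); apply: (@kahler_d_deg 1%N); apply: var_homog. Qed.

Lemma coord_var_deg n : coord_deg 1 (xx n).
Proof. exact/(@coord_deg_to_coord _ _ 1%N)/var_homog. Qed.

Lemma cross_deg i D n : @gdeg R (gdual (@coord_deg k f) Om) i D ->
  coord_deg (i + 2) (cross D n).
Proof.
move=> Di; have -> : i + 2 = i + 1 + 1 by rewrite -addrA.
by case: n => [|[|n]]; apply: coord_degB; apply: coord_degM;
  (exact: coord_var_deg || exact: dx_deg).
Qed.

(** Cross products raise the degree by 2, and [u ^ (m + 2) * w D] is a combination of them with
    coefficients of degree [m]; dividing by the power of [u] brings the degree back to that of
    [D]. *)
Lemma omega_deg (w : dual (dual Om)) : (forall D, is_omega D (w D)) ->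
  @gdeg R (gbidual (@coord_deg k f) Om) 0 w.
Proof.
move=> wP i D Di; rewrite add0r.
have [m [A [homA AE]]] := ul_jac.
have u_homog : ul ^+ m.+2 \is ishomog1 m.+2 mdeg.
  by have := dhomogMn m.+2 (ul_homog a); rewrite mul1n.
apply: (coord_deg_div f_homog u_homog).
  move=> y; rewrite rmorphXn => uy; apply: (reg_pow_inj (n := m.+2) u_reg).
  by rewrite mulr0.
have -> : tc (ul ^+ m.+2) * w D = \sum_(j < 3) tc (A j) * cross D j.
  have [c0 c1 c2] := wP D.
  rewrite -AE rmorph_sum mulr_suml; apply: eq_bigr; apply: ord3_ind => _;
    rewrite rmorphM -mulrA !inordK //; congr (_ * _).
  - by rewrite c0 mulrC.
  - by rewrite c1 mulrC.
  - by rewrite c2 mulrC.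
have -> : i + m.+2%:Z = m%:Z + (i + 2) by lia.
apply: coord_deg_sum => j; apply: coord_degM (cross_deg _ Di).
exact: coord_deg_to_coord.
Qed.

Lemma euler_der_deg Eu : (forall n, (n < 3)%N -> dx Eu n = xx n) ->
  @gdeg R (gdual (@coord_deg k f) Om) 0 Eu.
Proof.
move=> EuE j m; rewrite add0r => jm.
apply: (jm [set m | coord_deg j (Eu m)]); split=> [|_ [i [l [c [x [-> ci xl ->]]]]]] /=.
  split=> [|y z /= yj zj]; first by rewrite linear0; apply: coord_deg0.
  by rewrite linearB; apply: coord_degB.
rewrite -[Eu _]/(Eu (c *: kahler_d x)) dual_appZ; apply: coord_degM => //.
case: l xl => n /= => [[p homp <-]|->]; last first.
  have -> : (0 : R) = tc (mpolyC 3 0) by rewrite mpolyC0 rmorph0.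
  by rewrite der_const mpolyC0 rmorph0.
exists (p *+ n); first by rewrite rpredMn.
rewrite der_chain -(euler_homog homp) rmorph_sum; apply: eq_bigr => i0 _.
rewrite rmorphM; congr (_ * _).
by have := EuE i0 (ltn_ord i0); rewrite /dx /xx inord_val.
Qed.

Local Notation ca := (tc (mpolyC 3 a)).
Local Notation cb := (tc (mpolyC 3 b)).

Lemma tc_ul : tc ul = xx 0 - ca * xx 2.
Proof. by rewrite /ul rmorphB rmorphM. Qed.

Lemma tc_vl : tc vl = xx 1 - cb * xx 2.
Proof. by rewrite /vl rmorphB rmorphM. Qed.

Lemma tc_gl : tc gl = ca * ff 0 + cb * ff 1 + ff 2.
Proof.
rewrite /gl big_ord3 !rmorphD !rmorphM /= pt0 pt1 pt2 mpolyC1 rmorph1 mul1r.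
by [].
Qed.

Lemma der_sub_const (D : dual Om) c i j :
  D (kahler_d (tc (mX (inord i) - mpolyC 3 c * mX (inord j)))) =
  dx D i - tc (mpolyC 3 c) * dx D j.
Proof.
rewrite -mulNr -rmorphN rmorphD rmorphM der_add der_mul der_const mulr0 addr0.
by rewrite rmorphN rmorphN mulNr.
Qed.

Hypothesis one_neq0 : (1 : R) != 0.
Hypothesis g_const : forall c x y : R, coord_deg 0 c ->
  tc gl * c = tc vl * x - tc ul * y -> c = 0.

Lemma calC_frk_rank q :
  (forall n, splits_free (@coord_deg k f) (calC f q) n -> (n <= 1)%N) /\
  is_rank (calC f q) q.+1.
Proof.
have e := coord_euler.
(* [Hu], [Hv] are the cross products of the gradients of [ul], [vl] with that of [f]. *)
have [Eu [Eu0 Eu1 Eu2]] := der_dx e.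
have [|Hu [Hu0 Hu1 Hu2]] := @der_dx (ca * ff 1) (- ca * ff 0 - ff 2) (ff 1).
  by ring.
have [|Hv [Hv0 Hv1 Hv2]] := @der_dx (ff 2 + cb * ff 1) (- cb * ff 0) (- ff 0).
  by ring.
have [w wP] := omega_exists_dual.
(* The identities below hold up to a multiple of Euler's relation; the argument [c] is that
   multiplier, read off by expanding. *)
have euler_mul c x y : x - y = c * (xx 0 * ff 0 + xx 1 * ff 1 + xx 2 * ff 2) -> x = y.
  by rewrite e mulr0 => /eqP; rewrite subr_eq0 => /eqP.
have Dul (D : dual Om) : D (kahler_d (tc ul)) = dx D 0 - ca * dx D 2.
  exact: der_sub_const.
have Dvl (D : dual Om) : D (kahler_d (tc vl)) = dx D 1 - cb * dx D 2.
  exact: der_sub_const.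
have dxZ x (D : dual Om) n : dx (x *: D) n = x * dx D n by [].
have dxD (D D' : dual Om) n : dx (D + D') n = dx D n + dx D' n by [].
(* Up to [u], the derivations [Eu] and [Hu] form a basis, with coordinates [D (d u)] and [w D];
   dualising gives [chart_u]. *)
have uD (D : dual Om) : tc ul *: D = D (kahler_d (tc ul)) *: Eu + w D *: Hu.
  have [c0 c1 c2] := wP D; move: c0 c1 c2; rewrite /cross => c0 c1 c2.
  apply: dx_ext; rewrite dxD !dxZ Dul tc_ul.
  - rewrite Eu0 Hu0; transitivity ((dx D 0 - ca * dx D 2) * xx 0 + ca * (w D * ff 1)).
      rewrite -c1; ring.
    ring.
  - rewrite Eu1 Hu1; transitivity ((dx D 0 - ca * dx D 2) * xx 1
      - ca * (w D * ff 0) - w D * ff 2).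
      rewrite -c0 -c2; ring.
    ring.
  - rewrite Eu2 Hu2 -c1; ring.
have HvHu : tc vl *: Hu = tc ul *: Hv - tc gl *: Eu.
  have dxB (D D' : dual Om) n : dx (D - D') n = dx D n - dx D' n by [].
  apply: dx_ext; rewrite dxB !dxZ ?Hu0 ?Hu1 ?Hu2 ?Hv0 ?Hv1 ?Hv2 ?Eu0 ?Eu1 ?Eu2
    tc_ul tc_vl tc_gl.
  - apply: (euler_mul ca); ring.
  - apply: (euler_mul cb); ring.
  - apply: (euler_mul 1); ring.
have wEu : w Eu = 0.
  apply: (omega_unique (wP Eu)).
  by split; rewrite /cross ?Eu0 ?Eu1 ?Eu2; ring.
have wHu : w Hu = tc ul.
  apply: (omega_unique (wP Hu)); split; rewrite /cross ?Hu0 ?Hu1 ?Hu2 tc_ul.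
  - apply: (euler_mul (- 1)); ring.
  - ring.
  - apply: (euler_mul ca); ring.
pose du : dual (dual Om) := eval (kahler_d (tc ul)).
pose dv : dual (dual Om) := eval (kahler_d (tc vl)).
(* At [D], [v du - u dv] is the point [(a, b, 1)] paired with the cross product of [D]; replacing
   the latter by [w D] times the gradient produces the polar conic. *)
have change_d : tc vl *: du = tc ul *: dv + tc gl *: w.
  apply: dual_ext => D; have [c0 c1 c2] := wP D.
  rewrite -[LHS]/(tc vl * D (kahler_d (tc ul))).
  rewrite -[RHS]/(tc ul * D (kahler_d (tc vl)) + tc gl * w D) Dul Dvl tc_ul tc_vl tc_gl.
  transitivity ((xx 0 - ca * xx 2) * (dx D 1 - cb * dx D 2)
    + (ca * (w D * ff 0) + cb * (w D * ff 1) + w D * ff 2)); last by ring.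
  rewrite -c0 -c1 -c2 /cross; ring.
have chart_u (s : dual (dual Om)) : tc ul *: s = s Eu *: du + s Hu *: w.
  apply: dual_ext => D; rewrite -[LHS]/(tc ul * s D) -dual_appZ uD.
  have -> : s (D (kahler_d (tc ul)) *: Eu + w D *: Hu) =
      s (D (kahler_d (tc ul)) *: Eu) + s (w D *: Hu) by rewrite linearD.
  rewrite !dual_appZ -[RHS]/(s Eu * D (kahler_d (tc ul)) + s Hu * w D).
  by rewrite mulrC [w D * _]mulrC.
(* The chart computations use polynomials over R, hence its structure of a nonzero ring. *)
pose A : comNzRingType := HB.pack R (GRing.PzSemiRing_isNonZero.Build R one_neq0).
pose gA : int -> set A := @coord_deg k f.
pose E : gmod A := gbidual (@coord_deg k f) Om.
pose eu : {linear E -> A^o} := eval_fun Eu.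
pose hu : {linear E -> A^o} := eval_fun Hu.
pose hv : {linear E -> A^o} := eval_fun Hv.
have eu_du : eu du = tc ul.
  by rewrite -[LHS]/(Eu (kahler_d (tc ul))) [LHS]Dul Eu0 Eu2 tc_ul.
have eu_w : eu w = 0 by exact: wEu.
have hu_du : hu du = 0.
  rewrite -[LHS]/(Hu (kahler_d (tc ul))) [LHS]Dul Hu0 Hu2; ring.
have hu_w : hu w = tc ul by exact: wHu.
have change_h (s : E) : tc vl * hu s = tc ul * hv s - tc gl * eu s.
  have : s (tc vl *: Hu) = s (tc ul *: Hv - tc gl *: Eu) by rewrite HvHu.
  have -> : s (tc ul *: Hv - tc gl *: Eu) = s (tc ul *: Hv) - s (tc gl *: Eu).
    by rewrite linearB.
  by rewrite !dual_appZ.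
have Eu_deg : @gdeg R (gdual (@coord_deg k f) Om) 0 Eu.
  by apply: euler_der_deg => -[|[|[|]]].
split=> [n|].
  refine (@frk_le1 A gA E eu hu hv w du dv (tc ul) (tc vl) (tc gl) chart_u change_d
    change_h u_reg vu_reg _ _ _ _ _ _ _ _ _ _ q n).
  - exact: coord_deg0.
  - exact: coord_degB.
  - exact: coord_deg1.
  - exact: coord_degM.
  - exact: coord_deg_neg.
  - move=> i l x xi; apply: (coord_deg_div f_homog (w := ul ^+ l) (e := l)).
    + by have := dhomogMn l (ul_homog a); rewrite mul1n.
    + move=> y; rewrite rmorphXn => uy; apply: (reg_pow_inj (n := l) u_reg).
      by rewrite uy mulr0.
    + by rewrite rmorphXn.
  - exact: g_const.
  - by move=> i s si; rewrite -[i]addr0; apply: si.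
  - exact: omega_deg.
  - by move=> j D Dj; rewrite addrC; apply: Dj; apply: (@kahler_d_deg 1%N); apply: ul_homog.
exact: (@chart_rank A gA E eu hu du w (tc ul) q chart_u eu_du eu_w hu_du hu_w u_reg).
Qed.

End InvariantDifferential.

(** * Consequences of non-singularity *)

Lemma mmap_deriv (n : nat) (k : comNzRingType) (h : 'I_n -> {poly k}) i
    (p : mpoly n k) :
  (forall j, (h j)^`() = (i == j)%:R) ->
  (mmap polyC h p)^`() = mmap polyC h (mderiv i p).
Proof.
move=> hj; pose phi : {rmorphism mpoly n k -> {poly k}} := mmap polyC h.
rewrite -/(phi p) -/(phi (mderiv i p)).
move: p; apply: mpoly_ring_ind => [c|j|p q IHp IHq|p q IHp IHq].
- by rewrite mderivC rmorph0 /phi /= mmapC derivC.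
- by rewrite mderiv_var rmorph_nat -hj /phi /= mmapX mmap1U.
- by rewrite linearD !rmorphD derivD IHp IHq.
by rewrite mderivM rmorphD !rmorphM derivM IHp IHq.
Qed.

(** A nonzero coordinate is scaled to 1. At a point of the curve the definition applies; elsewhere
    Euler's formula and [3 != 0] exclude a zero gradient. *)
Lemma nonsingular_grad (k : fieldType) (f : mpoly 3 k) : 3%:R != 0 :> k ->
  f \is ishomog1 3 mdeg -> nonsingular f ->
  forall v : 'I_3 -> k, (exists i, v i != 0) -> exists j, meval v (mderiv j f) != 0.
Proof.
move=> three_neq0 f_homog f_ns v [i vi].
pose w j := (v i)^-1 * v j.
have scale j : meval w (mderiv j f) != 0 -> meval v (mderiv j f) != 0.
  rewrite /meval (mmap_homog_scale idfun v _ (mderiv_homog j f_homog)).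
  by rewrite mulf_eq0 negb_or => /andP[].
have [fw|fw] := eqVneq (meval w f) 0.
  have wi : w i = 1 by rewrite /w mulVf.
  by have [j _ /scale] := f_ns i w wi fw; exists j.
apply: contrapT => noj; move: fw; apply/negP/negPn.
have -> : meval w f = 3%:R^-1 * \sum_j meval w (mX j * mderiv j f).
  rewrite -rmorph_sum (euler_homog f_homog) rmorphMn /=.
  by rewrite -[meval w f *+ 3]mulr_natl mulKf.
rewrite big1 ?mulr0 // => j _; rewrite rmorphM /=.
have [->|/scale nz] := eqVneq (meval w (mderiv j f)) 0; first by rewrite mulr0.
by case: noj; exists j.
Qed.

(* If [f] vanished on the whole chart [z = 1], so would its derivatives along it. *)
Lemma nonvanishing_pt (k : closedFieldType) (f : mpoly 3 k) : nonsingular f ->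
  exists a b : k, meval (pt a b) f != 0.
Proof.
move=> f_ns; apply: contrapT => vanish.
have f0 a b : meval (pt a b) f = 0.
  by apply/eqP/negPn/negP => nz; apply: vanish; exists a, b.
have [|j j2] := f_ns (inord 2) (pt 0 0) _ (f0 0 0); first by rewrite pt2.
apply/negP/negPn.
pose h (i : 'I_3) : {poly k} := if i == j then 'X else (pt 0 0 i)%:P.
have eval_h t (p : mpoly 3 k) :
    (mmap polyC h p).[t] = meval (fun i => if i == j then t else pt 0 0 i) p.
  pose phi : {rmorphism mpoly 3 k -> k} := horner_eval t \o mmap polyC h.
  rewrite -[LHS]/(phi p); move: p; apply: mpoly_rmorph_ext => [c|i].
    by rewrite /phi /= /horner_eval mmapC hornerC mevalC.
  rewrite /phi /= /horner_eval mmapX mmap1U mevalXU /h.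
  by case: eqP; rewrite ?hornerX ?hornerC.
have pt_line t : exists a b : k,
    forall i, (if i == j then t else pt 0 0 i) = pt a b i.
  have : (j == inord 0) || (j == inord 1).
    move: j2; move: (j).
    apply: (@ord3_ind (fun j => j != inord 2 -> (j == inord 0) || (j == inord 1))).
    - by rewrite eqxx.
    - by rewrite eqxx orbT.
    - by rewrite eqxx.
  case/orP => /eqP ->.
    exists t, 0; apply: ord3_ind; rewrite !inord3_eq //= ?pt0 ?pt1 ?pt2 //.
  exists 0, t; apply: ord3_ind; rewrite !inord3_eq //= ?pt0 ?pt1 ?pt2 //.
have hf0 : mmap polyC h f = 0.
  apply/eqP/negPn/negP => /closed_nonrootP[t]; rewrite /root eval_h.
  have [a [b E]] := pt_line t; rewrite (meval_eq _ E) f0.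
  by rewrite eqxx.
have : mmap polyC h (mderiv j f) = 0.
  rewrite -(@mmap_deriv _ _ h j) ?hf0 ?deriv0 // => i; rewrite /h eq_sym.
  by case: eqP => _; rewrite ?derivX ?derivC.
move=> /(congr1 (horner^~ (pt 0 0 j))); rewrite eval_h horner0 => e0.
by apply/eqP; rewrite -[RHS]e0; apply: meval_eq => i; case: eqP => [->|].
Qed.

(** * The signature *)

Section Jacobians.
Variables (k : closedFieldType) (f : mpoly 3 k) (a b : k).
Hypothesis three_neq0 : 3%:R != 0 :> k.
Hypothesis f_homog : f \is ishomog1 3 mdeg.
Hypothesis grad_neq0 : forall v : 'I_3 -> k,
  (exists i, v i != 0) -> exists j, meval v (mderiv j f) != 0.
Hypothesis fpt : meval (pt a b) f != 0.

(** The chart is the plane [ul = 1], parametrised from [(1, 0, 0)] along [(0, 1, 0)] and [pt]; its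
    two parameters are the restrictions of [vl] and of the third variable. *)
Lemma ul_jacobian : exists n (A : 'I_3 -> mpoly 3 k),
  (forall i, A i \is ishomog1 n mdeg) /\ \sum_i A i * mderiv i f = ul a ^+ n.+2.
Proof.
pose p i : k := (i == inord 0 :> 'I_3)%:R; pose q i : k := (i == inord 1 :> 'I_3)%:R.
apply: (@jacobian_power k f three_neq0 f_homog grad_neq0 p q (pt a b) fpt _
  (vl b) (mX (inord 2)) (ul a) (ul_homog a)).
  move=> s t; have [t0|t0] := eqVneq t 0.
    exists (inord 0); rewrite t0 mulr0 addr0 /p /q !inord3_eq //.
    by rewrite mul0r addr0 oner_eq0.
  by exists (inord 2); rewrite pt2 mul1r /p /q !inord3_eq // mul0r !add0r.
apply: ord3_ind; rewrite /p /q !inord3_eq //= ?pt0 ?pt1 ?pt2 ?mpolyC1 ?mpolyC0.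
- by exists (- 1); rewrite /ul; ring.
- by exists 0; rewrite /vl; ring.
- by exists 0; ring.
Qed.

(** Symmetric to [ul_jacobian], with the first two axes exchanged. *)
Lemma vl_jacobian : exists n (A : 'I_3 -> mpoly 3 k),
  (forall i, A i \is ishomog1 n mdeg) /\ \sum_i A i * mderiv i f = vl b ^+ n.+2.
Proof.
pose p i : k := (i == inord 1 :> 'I_3)%:R; pose q i : k := (i == inord 0 :> 'I_3)%:R.
apply: (@jacobian_power k f three_neq0 f_homog grad_neq0 p q (pt a b) fpt _
  (ul a) (mX (inord 2)) (vl b) (vl_homog b)).
  move=> s t; have [t0|t0] := eqVneq t 0.
    exists (inord 1); rewrite t0 mulr0 addr0 /p /q !inord3_eq //.
    by rewrite mul0r addr0 oner_eq0.
  by exists (inord 2); rewrite pt2 mul1r /p /q !inord3_eq // mul0r !add0r.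
apply: ord3_ind; rewrite /p /q !inord3_eq //= ?pt0 ?pt1 ?pt2 ?mpolyC1 ?mpolyC0.
- by exists 0; rewrite /ul; ring.
- by exists (- 1); rewrite /vl; ring.
- by exists 0; ring.
Qed.

Lemma coord_one_neq0 : (1 : coord_ring f) != 0.
Proof.
apply/eqP => one0; have [q qE] := (to_coord_eq0 f 1).1 one0.
have := congr1 (pihomog mdeg 0) qE.
rewrite mulrC (pihomog_mul_lt _ f_homog) // pihomog_dE ?dhomog1 // => /eqP.
by rewrite oner_eq0.
Qed.

End Jacobians.

Lemma splits_free0 (A : comPzRingType) (gA : int -> set A) (M : gmod A) :
  (forall j, @gdeg A M j 0) -> splits_free gA M 0.
Proof.
move=> M0; exists (fun=> 0), \0, \0; split=> [j m _ [] //|j m _|v] /=.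
  exact: M0.
by apply/rowP => -[].
Qed.

(** A classical case distinction decides between 0 and 1; the limit depends only on the bound. *)
Lemma frk_exists (A : comPzRingType) (gA : int -> set A) (M : gmod A) :
  (forall j, @gdeg A M j 0) -> (forall n, splits_free gA M n -> (n <= 1)%N) ->
  exists2 n, is_frk gA M n & (n <= 1)%N.
Proof.
move=> M0 M1; have [M_1|M_1] := pselect (splits_free gA M 1).
  by exists 1%N.
exists 0%N => //; split; first exact: splits_free0.
by move=> [|n] // Mn; have := M1 _ Mn; case: n Mn.
Qed.

(** The numerator is at most [N + 1] and the denominator at least half of [(N + 1) ^ 2], so the
    ratio is at most [2 / (N + 1)], which is [2 * harmonic N]. *)
Lemma ratio_cvg0 (K : realType) (x : nat -> nat) : (forall q, (x q <= 1)%N) ->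
  ((\sum_(0 <= q < N.+1) x q)%:R / (\sum_(0 <= q < N.+1) q.+1)%:R : K)
    @[N --> \oo] --> (0 : K).
Proof.
move=> x1.
have sum_x N : (\sum_(0 <= q < N.+1) x q <= N.+1)%N.
  apply: leq_trans (leq_sum _ (fun q _ => x1 q)) _.
  by rewrite sum_nat_const_nat subn0 muln1.
have sum_rk N : (N.+1 * N.+1 <= 2 * \sum_(0 <= q < N.+1) q.+1)%N.
  elim: N => [|N IHN]; first by rewrite big_nat1.
  by rewrite big_nat_recr //= mulnDr; move: IHN; lia.
have harm : (2 * harmonic N : K) @[N --> \oo] --> (0 : K).
  by rewrite -[X in _ --> X](mulr0 2); apply: cvgMr; apply: cvg_harmonic.
apply: (squeeze_cvgr _ (cvg_cst 0) harm); apply: nearW => N.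
rewrite divr_ge0 //=.
have pos : (0 < \sum_(0 <= q < N.+1) q.+1)%N.
  by have := sum_rk N; case: (\sum_(0 <= q < N.+1) q.+1)%N => //.
rewrite ler_pdivrMr ?ltr0n // mulrAC ler_pdivlMr ?ltr0n // -!natrM ler_nat.
by rewrite (leq_trans _ (sum_rk N)) // leq_mul2r sum_x orbT.
Qed.

Theorem theorem4p14 (K : realType) (k : closedFieldType)
    (char_not2 : 2%N \notin [pchar k]) (char_not3 : 3%N \notin [pchar k])
    (f : mpoly 3 k) (f_homog : f \is ishomog1 3 mdeg)
    (f_nonsing : nonsingular f) :
  is_diff_signature f (0 : K).
Proof.
have three_neq0 : 3%:R != 0 :> k by apply: contra char_not3; rewrite inE.
have grad_neq0 := nonsingular_grad three_neq0 f_homog f_nonsing.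
have [a [b fab]] := nonvanishing_pt f_nonsing.
have frk_rk q := @calC_frk_rank k f a b f_homog (ul_reg fab) (vl_ul_reg fab)
  (ul_jacobian three_neq0 f_homog grad_neq0 fab)
  (vl_jacobian three_neq0 f_homog grad_neq0 fab)
  (coord_one_neq0 f_homog) (gl_const three_neq0 f_homog fab) q.
have frkP q : exists n, is_frk (@coord_deg k f) (calC f q) n /\ (n <= 1)%N.
  have [|n nP n1] := frk_exists _ (frk_rk q).1; last by exists n.
  by move=> j l psi _; apply: coord_deg0.
exists (fun q => projT1 (cid (frkP q))), (fun q => q.+1); split=> [q|q|].
- by case: cid => n [].
- exact: (frk_rk q).2.
by apply: ratio_cvg0 => q; case: cid => n [].
Qed.
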